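(* Let $p>1$ and let $[X,\mathcal B,m^1,\nu_1]$, $[X,\mathcal B,m^2,\nu_2]$ be two reversible random walk spaces on the same measurable space with $\nu_2\ll\nu_1$, $\mu:=\frac{d\nu_2}{d\nu_1}\in L^\infty(X,\nu_1)$, and suppose there is $c>0$ with $\mu\ge c$ $\nu_1$-a.e. Assume either (a) $\nu_1(X)<\infty$, or (b) $\nu_1(X)=+\infty$ and $p\ge2$. Then, with $H=L^2(X,\nu_1)$, $$\partial_H\big(\mathcal F_{1,m^1}+\mathcal F_{p,m^2}\big)=-\Delta_1^{m^1}-\mu\Delta_p^{m^2}.$$ Moreover, this operator is completely accretive in $H$ and has dense domain in $H$.
   Context: A random walk space $[X,\mathcal B,m,\nu]$ consists of a measurable space $(X,\mathcal B)$ with $\mathcal B$ countably generated, a family $m=(m_x)_{x\in X}$ of probability measures on $\mathcal B$ with $x\mapsto m_x(B)$ measurable for each $B$, and a $\sigma$-finite measure $\nu$ with $\nu(A)=\int_X m_x(A)\,d\nu(x)$ for all $A$; it is reversible if $dm_x(y)\,d\nu(x)=dm_y(x)\,d\nu(y)$. $\nu\otimes m_x$ is the measure on $X\times X$ with $(\nu\otimes m_x)(A\times B)=\int_A m_x(B)\,d\nu(x)$; $\nabla u(x,y)=u(y)-u(x)$. On $H=L^2(X,\nu_1)$ (note $H\subset L^2(X,\nu_2)$ since $\mu$ is bounded): $\mathcal F_{1,m^1}(u)=\frac12\int_{X\times X}|\nabla u|\,d(\nu_1\otimes m^1_x)$ and $\mathcal F_{p,m^2}(u)=\frac1{2p}\int_{X\times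 X}|\nabla u|^p\,d(\nu_2\otimes m^2_x)$, each set to $+\infty$ when the integral is infinite. For a proper convex $\mathcal F$ on a Hilbert space $H$, $\partial_H\mathcal F(u)=\{v\in H:\mathcal F(w)-\mathcal F(u)\ge(v,w-u)\ \forall w\in H\}$. In a random walk space $[X,\mathcal B,m,\nu]$: $(u,v)\in\Delta_1^m$ iff $(u,-v)\in\partial_{L^2(X,\nu)}\mathcal F_{1,m}(u)$, where $\mathcal F_{1,m}(u)=\frac12\int|\nabla u|\,d(\nu\otimes m_x)$; and for $p>1$, $(u,v)\in\Delta_p^m$ iff $u,v\in L^2(X,\nu)$, $\nabla u\in L^p(\nu\otimes m_x)$ and $v(x)=\int_X|\nabla u(x,y)|^{p-2}\nabla u(x,y)\,dm_x(y)$. The operator $-\Delta_1^{m^1}-\mu\Delta_p^{m^2}$ on $H$ is the set of pairs $(u,v)$, $u,v\in H$, such that $v=v_1+v_2$ with $(u,-v_1)\in\Delta_1^{m^1}$ (in $[X,\mathcal B,m^1,\nu_1]$) and $v_2=-\mu w$ with $(u,w)\in\Delta_p^{m^2}$ (in $[X,\mathcal B,m^2,\nu_2]$). Complete accretivity of $A\subset H\times H$: for all $\lambda>0$ and $(u_1,v_1),(u_2,v_2)\in A$, $\int j(u_1-u_2)\,d\nu_1\le\int j(u_1-u_2+\lambda(v_1-v_2))\,d\nu_1$ for every convex lower semicontinuous $j:\mathbb R\to[0,\infty]$ with $j(0)=0$. *)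

(* Defs.v *)
From HB Require Import structures.
From mathcomp Require Import all_boot all_order all_algebra.
From mathcomp Require Import all_classical all_reals all_analysis.
Set Implicit Arguments. Unset Strict Implicit. Unset Printing Implicit Defensive.
Import Order.TTheory GRing.Theory Num.Theory.
Import numFieldNormedType.Exports.
Local Open Scope classical_set_scope.
Local Open Scope ring_scope.

Section random_walk_defs.
Context {d : measure_display} {T : measurableType d} {R : realType}.

Definition countably_generated : Prop :=
  exists G : nat -> set T, (@measurable d T) = <<s range G>>.

Definition invariant_measure (m : R.-pker T ~> T) (nu : {measure set T -> \bar R}) :=
  forall A, measurable A -> nu A = (\int[nu]_x m x A)%E.

Definition random_walk_space (m : R.-pker T ~> T) (nu : {measure set T -> \bar R}) :=
  [/\ countably_generated, sigma_finite [set: T] nu & invariant_measure m nu].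

(* reversibility: dm_x(y)dnu(x) = dm_y(x)dnu(y), i.e. the measure nu (x) m_x on
   X x X is symmetric; stated on measurable rectangles A x B *)
Definition reversible (m : R.-pker T ~> T) (nu : {measure set T -> \bar R}) :=
  forall A B, measurable A -> measurable B ->
    (\int[nu]_(x in A) m x B = \int[nu]_(x in B) m x A)%E.

Definition inL2 (nu : {measure set T -> \bar R}) (u : T -> R) :=
  measurable_fun [set: T] u /\ (\int[nu]_x ((u x) ^+ 2)%:E < +oo)%E.

Definition F1 (nu : {measure set T -> \bar R}) (m : R.-pker T ~> T) (u : T -> R)
  : \bar R :=
  ((2^-1)%:E * \int[nu]_x \int[m x]_y (`|u y - u x|)%:E)%E.

Definition Fp (p : R) (nu : {measure set T -> \bar R}) (m : R.-pker T ~> T)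
  (u : T -> R) : \bar R :=
  (((2 * p)^-1)%:E * \int[nu]_x \int[m x]_y (`|u y - u x| `^ p)%:E)%E.

Definition subdiff (nu : {measure set T -> \bar R}) (F : (T -> R) -> \bar R)
  (u v : T -> R) :=
  [/\ inL2 nu u, inL2 nu v, (F u < +oo)%E &
    forall w, inL2 nu w ->
      (F u + \int[nu]_x (v x * (w x - u x))%:E <= F w)%E].

Definition Delta1 (nu : {measure set T -> \bar R}) (m : R.-pker T ~> T)
  (u v : T -> R) := subdiff nu (F1 nu m) u (fun x => - v x).

(* |t|^{p-2} t *)
Definition sgpow (p t : R) : R := Num.sg t * `|t| `^ (p - 1).

Definition Deltap (p : R) (nu : {measure set T -> \bar R}) (m : R.-pker T ~> T)
  (u v : T -> R) :=
  [/\ inL2 nu u, inL2 nu v,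
      (\int[nu]_x \int[m x]_y (`|u y - u x| `^ p)%:E < +oo)%E &
      {ae nu, forall x, v x = Rintegral (m x) [set: T] (fun y => sgpow p (u y - u x))}].

Definition opA (p : R) (nu1 : {measure set T -> \bar R}) (m1 : R.-pker T ~> T)
  (nu2 : {measure set T -> \bar R}) (m2 : R.-pker T ~> T) (mu : T -> R)
  (u v : T -> R) :=
  [/\ inL2 nu1 u, inL2 nu1 v &
    exists v1 v2 w : T -> R,
      [/\ Delta1 nu1 m1 u (fun x => - v1 x),
          Deltap p nu2 m2 u w,
          {ae nu1, forall x, v2 x = - (mu x * w x)} &
          {ae nu1, forall x, v x = v1 x + v2 x}]].

Definition convex_ext (j : R -> \bar R) :=
  forall x y t : R, (0 <= t <= 1)%R ->
    (j (t * x + (1 - t) * y)%R <= t%:E * j x + (1 - t)%R%:E * j y)%E.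

Definition completely_accretive (nu : {measure set T -> \bar R})
  (A : (T -> R) -> (T -> R) -> Prop) :=
  forall (lam : R), 0 < lam -> forall u1 v1 u2 v2, A u1 v1 -> A u2 v2 ->
  forall j : R -> \bar R, convex_ext j -> lower_semicontinuous j ->
    (forall t, 0 <= j t)%E -> j 0 = 0%E ->
    (\int[nu]_x j (u1 x - u2 x)%R
      <= \int[nu]_x j (u1 x - u2 x + lam * (v1 x - v2 x))%R)%E.

Definition dense_domain (nu : {measure set T -> \bar R})
  (A : (T -> R) -> (T -> R) -> Prop) :=
  forall f, inL2 nu f -> forall eps : R, 0 < eps ->
    exists u, (exists v, A u v) /\
      (\int[nu]_x ((f x - u x) ^+ 2)%:E < eps%:E)%E.

End random_walk_defs.

(* Main.v *)
(* On X x X let N_i be the measure nu_i (x) m^i_x. It is invariant under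
   (x, y) |-> (y, x), so an antisymmetric G satisfies the integration by parts
   formula  int G grad(phi) dN_i = - 2 int phi(x) (int G(x, .) dm^i_x) dnu_i(x).

   Inclusion of the operator in the subdifferential: tangent inequality for
   |t|^p, plus integration by parts with G = |grad u|^(p-2) grad u (first for
   truncated test functions, then by dominated convergence).

   Converse: differentiating F_p at u along phi shows that
   g := v + mu Delta_p u satisfies  F_1(u) + (g, phi) <= F_1(u + phi)  for all
   bounded phi in L^2. As F_1(u + phi) - F_1(u) <= ||phi||_1, we get |g| <= 1,
   which forces g, hence Delta_p u, to be in L^2: trivially if nu_1 is finite,
   and for p >= 2 because min(1, |Delta_p u|)^2 <= 4 int |grad u|^p dm_x.

   Complete accretivity: by Moreau-Yosida regularization j may be replaced by
   a C^1 function with monotone Lipschitz derivative q vanishing at 0, and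
   int q(u1 - u2) (v1 - v2) >= 0 holds for each of the two parts.

   Density: a bounded u whose support has finite measure is in the domain, with
   - int sg(u(y) - u(x)) dm^1_x(y)  as an element of the subdifferential of F_1.
*)
Require Import Defs.
From HB Require Import structures.
From mathcomp Require Import all_boot all_order all_algebra.
From mathcomp Require Import all_classical all_reals all_analysis.
From mathcomp Require Import unstable measurable_realfun lra ring.
Set Implicit Arguments.
Unset Strict Implicit.
Unset Printing Implicit Defensive.
Import Order.TTheory GRing.Theory Num.Theory.
Import numFieldNormedType.Exports.
Local Open Scope classical_set_scope.
Local Open Scope ring_scope.

(** What shapes the converse is that Delta_p u is at the outset merely a measurable function, since
    finite energy does not make it square integrable, and that F_p may be infinite at u + phi for a
    general phi in L^2. Instead of a sum rule for subdifferentials, the proof tests with phi in both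
    L^2 and L^p; bounded functions of L^2 qualify under either alternative (a) or (b). The remainder
    g is not built from signs of the gradient: it is what is left of v, and |g| <= 1 serves both to
    reach L^2 and to return from bounded tests to all of L^2. The minimum with 1 is harmless when p
    >= 2, because |g| <= 1 already controls g where |Delta_p u| > 1. The bounds c <= mu <= M
    identify L^2(nu_1) with L^2(nu_2), and c > 0 recovers Delta_p u from mu Delta_p u.

    In the accretivity part j may take the value +oo; its regularization grows at most
    quadratically, so it has finite integrals along L^2 functions. As F_1 is not differentiable, the
    sign of its contribution comes from evaluating F_1 at two competitors rather than from comparing
    gradients. *)

(** * Real-valued integrals and square-integrable functions *)

Section real_integral.
Context {d : measure_display} {T : measurableType d} {R : realType}.
Variable mu : {measure set T -> \bar R}.
Implicit Types f g h : T -> R.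

(** [RI f] is [fine] of the extended integral, hence meaningful only next to [Lint f]. Keeping the
    two apart leaves inequalities between real numbers, to which [lra] applies. *)
Definition Lint f := mu.-integrable [set: T] (EFin \o f).
Definition RI f : R := Rintegral mu [set: T] f.

Lemma Lint_measurable f : Lint f -> measurable_fun [set: T] f.
Proof. by move=> /measurable_int /measurable_EFinP. Qed.

Lemma Lint_lty f : Lint f -> (\int[mu]_x (`|f x|)%:E < +oo)%E.
Proof. by case/integrableP. Qed.

Lemma EFin_RI f : Lint f -> (\int[mu]_x (f x)%:E)%E = (RI f)%:E.
Proof. by move=> lf; rewrite /RI /Rintegral fineK//; exact: integrable_fin_num. Qed.

Lemma Lint_ge0 f : measurable_fun [set: T] f -> (forall x, 0 <= f x) ->
  (\int[mu]_x (f x)%:E < +oo)%E -> Lint f.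
Proof.
move=> mf f0 fy; apply/integrableP; split; first exact/measurable_EFinP.
by under eq_integral do rewrite /= ger0_norm//.
Qed.

Lemma Lint_ge0_lty f : (forall x, 0 <= f x) -> Lint f ->
  (\int[mu]_x (f x)%:E < +oo)%E.
Proof. by move=> f0 lf; rewrite EFin_RI// ltry. Qed.

Lemma Lint_le f g : measurable_fun [set: T] f -> Lint g ->
  (forall x, `|f x| <= g x) -> Lint f.
Proof.
move=> mf lg fg; apply: le_integrable lg => //; first exact/measurable_EFinP.
by move=> x _ /=; rewrite lee_fin (le_trans (fg x))// ler_norm.
Qed.

Lemma Lint_ae_le f g : measurable_fun [set: T] f -> Lint g ->
  {ae mu, forall x, `|f x| <= g x} -> Lint f.
Proof.
move=> mf lg fg; apply/integrableP; split; first exact/measurable_EFinP.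
apply: le_lt_trans (Lint_lty lg); apply: ae_ge0_le_integral => //.
- by apply: measurableT_comp => //; exact/measurable_EFinP.
- by apply/measurable_EFinP/measurableT_comp => //; exact: Lint_measurable.
- by apply: filterS fg => x h _; rewrite lee_fin (le_trans h)// ler_norm.
Qed.

Lemma LintD f g : Lint f -> Lint g -> Lint (fun x => f x + g x).
Proof. by move=> lf lg; have := integrableD measurableT lf lg. Qed.

Lemma LintZ c f : Lint f -> Lint (fun x => c * f x).
Proof. by move=> lf; have := integrableZl measurableT c lf. Qed.

Lemma LintN f : Lint f -> Lint (fun x => - f x).
Proof. by move=> lf; have := integrableN lf. Qed.

Lemma LintB f g : Lint f -> Lint g -> Lint (fun x => f x - g x).
Proof. by move=> lf lg; apply: LintD => //; exact: LintN. Qed.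

Lemma Lint_norm f : Lint f -> Lint (fun x => `|f x|).
Proof. by move=> lf; have := integrable_norm lf. Qed.

Lemma Lint_eq f g : f =1 g -> Lint f -> Lint g.
Proof. by move=> /funext ->. Qed.

Lemma RI_D f g : Lint f -> Lint g -> RI (fun x => f x + g x) = RI f + RI g.
Proof. by move=> lf lg; rewrite /RI RintegralD. Qed.

Lemma RI_B f g : Lint f -> Lint g -> RI (fun x => f x - g x) = RI f - RI g.
Proof. by move=> lf lg; rewrite /RI RintegralB. Qed.

Lemma RI_Z c f : Lint f -> RI (fun x => c * f x) = c * RI f.
Proof. by move=> lf; rewrite /RI RintegralZl. Qed.

Lemma RI_N f : Lint f -> RI (fun x => - f x) = - RI f.
Proof.
move=> lf; rewrite -mulN1r -RI_Z//; congr RI.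
by apply/funext => x; rewrite mulN1r.
Qed.

Lemma RI_ae_eq f g : measurable_fun [set: T] f -> measurable_fun [set: T] g ->
  {ae mu, forall x, f x = g x} -> RI f = RI g.
Proof.
move=> mf mg fg; rewrite /RI /Rintegral; congr fine; apply: ae_eq_integral => //.
- exact/measurable_EFinP.
- exact/measurable_EFinP.
- by apply: filterS fg => x /= -> _.
Qed.

Lemma RI_ge0 f : (forall x, 0 <= f x) -> 0 <= RI f.
Proof. by move=> f0; apply: Rintegral_ge0. Qed.

Lemma RI_le f g : Lint f -> Lint g -> (forall x, f x <= g x) -> RI f <= RI g.
Proof. by move=> lf lg fg; apply: le_Rintegral. Qed.

Lemma Lint_ae_eq f g : measurable_fun [set: T] f -> Lint g ->
  {ae mu, forall x, f x = g x} -> Lint f.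
Proof.
move=> mf lg fg; apply: Lint_ae_le (Lint_norm lg) _ => //.
by apply: filterS fg => x ->.
Qed.

(** Replacing [g] by the maximum of [f] and [g], which agrees with it almost everywhere, reduces to
    the pointwise comparison. *)
Lemma RI_ae_le f g : Lint f -> Lint g -> {ae mu, forall x, f x <= g x} ->
  RI f <= RI g.
Proof.
move=> lf lg fg; have mf := Lint_measurable lf; have mg := Lint_measurable lg.
have mm : measurable_fun [set: T] (fun x => Num.max (f x) (g x)).
  exact: measurable_maxr.
have lm : Lint (fun x => Num.max (f x) (g x)).
  apply: Lint_le (LintD (Lint_norm lf) (Lint_norm lg)) _ => // x.
  by rewrite /Num.max; case: ifP => _; rewrite ?lerDl ?lerDr.
rewrite (_ : RI g = RI (fun x => Num.max (f x) (g x))).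
  by apply: RI_le => // x; rewrite le_max lexx.
by apply: RI_ae_eq => //; apply: filterS fg => x /max_idPr.
Qed.

(** Dominated convergence; the domination passes to the pointwise limit, so the integrability of [f]
    is part of the conclusion. *)
Lemma RI_cvg (f_ : nat -> T -> R) f g :
  (forall n, measurable_fun [set: T] (f_ n)) -> measurable_fun [set: T] f ->
  Lint g -> (forall n x, `|f_ n x| <= g x) ->
  (forall x, f_ n x @[n --> \oo] --> f x) ->
  Lint f /\ (RI (f_ n) @[n --> \oo] --> RI f).
Proof.
move=> mf_ mf lg fg cf.
have lf : Lint f.
  apply: Lint_le lg _ => // x.
  have nf : `|f_ n x| @[n --> \oo] --> `|f x| by exact: cvg_norm.
  rewrite -(cvg_lim _ nf)//; apply: limr_le; first by apply/cvg_ex; exists `|f x|.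
  by apply: nearW => n.
split => //.
have [] := @dominated_convergence _ _ _ mu _ measurableT (fun n => EFin \o f_ n)
  (EFin \o f) (EFin \o g).
- by move=> n; exact/measurable_EFinP.
- exact/measurable_EFinP.
- by apply: aeW => x _; apply: cvg_EFin; [exact: nearW|exact: cf].
- exact: lg.
- by apply: aeW => x n _ /=; rewrite lee_fin.
by move=> _ _ /=; rewrite EFin_RI// => /fine_cvgP[_].
Qed.

Lemma inL2P f :
  inL2 mu f <-> measurable_fun [set: T] f /\ Lint (fun x => f x ^+ 2).
Proof.
split=> -[mf lf]; split => //.
  by apply: Lint_ge0 => // [|x]; [exact: measurable_funX|exact: sqr_ge0].
by apply: Lint_ge0_lty => // x; exact: sqr_ge0.
Qed.

Lemma inL2_measurable f : inL2 mu f -> measurable_fun [set: T] f.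
Proof. by case. Qed.

Lemma inL2_ae_le f h : measurable_fun [set: T] f -> Lint h ->
  {ae mu, forall x, f x ^+ 2 <= h x} -> inL2 mu f.
Proof.
move=> mf lh fh; apply/inL2P; split => //.
apply: Lint_ae_le lh _; first exact: measurable_funX.
by apply: filterS fh => x; rewrite ger0_norm// sqr_ge0.
Qed.

Lemma inL2_le f h : measurable_fun [set: T] f -> Lint h ->
  (forall x, f x ^+ 2 <= h x) -> inL2 mu f.
Proof. by move=> mf lh fh; apply: inL2_ae_le lh _ => //; exact: aeW. Qed.

Lemma inL2_Lint_sqr f : inL2 mu f -> Lint (fun x => f x ^+ 2).
Proof. by case/inL2P. Qed.

Lemma inL2_Lint_mul f g : inL2 mu f -> inL2 mu g -> Lint (fun x => f x * g x).
Proof.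
move=> /inL2P[mf lf] /inL2P[mg lg].
apply: Lint_le (LintD lf lg) _ => [|x]; first exact: measurable_funM.
rewrite normrM; set a := `|f x|; set b := `|g x|.
have -> : f x ^+ 2 = a ^+ 2 by rewrite real_normK// num_real.
have -> : g x ^+ 2 = b ^+ 2 by rewrite real_normK// num_real.
have := sqr_ge0 (a - b); have := sqr_ge0 (a + b); nra.
Qed.

Lemma inL2D f g : inL2 mu f -> inL2 mu g -> inL2 mu (fun x => f x + g x).
Proof.
move=> /inL2P[mf lf] /inL2P[mg lg].
apply: (inL2_le (h := fun x => 2 * (f x ^+ 2 + g x ^+ 2))) => [||x].
- exact: measurable_funD.
- exact/LintZ/LintD.
- by have := sqr_ge0 (f x - g x); nra.
Qed.

Lemma inL2Z c f : inL2 mu f -> inL2 mu (fun x => c * f x).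
Proof.
move=> /inL2P[mf lf].
apply: (inL2_le (h := fun x => c ^+ 2 * f x ^+ 2)) => [||x].
- exact: measurable_funM.
- exact: LintZ.
- by rewrite exprMn.
Qed.

Lemma inL2N f : inL2 mu f -> inL2 mu (fun x => - f x).
Proof.
move=> /(inL2Z (-1)); congr inL2; apply/funext => x; by rewrite mulN1r.
Qed.

Lemma inL2B f g : inL2 mu f -> inL2 mu g -> inL2 mu (fun x => f x - g x).
Proof. by move=> Lf Lg; apply: inL2D => //; exact: inL2N. Qed.

Lemma inL2_norm_le f g : measurable_fun [set: T] f -> inL2 mu g ->
  (forall x, `|f x| <= `|g x|) -> inL2 mu f.
Proof.
move=> mf /inL2P[mg lg] fg; apply: inL2_le lg _ => // x.
rewrite -[f x ^+ 2]real_normK ?num_real// -[g x ^+ 2]real_normK ?num_real//.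
by rewrite lerXn2r// nnegrE.
Qed.

End real_integral.

(** * Integration against a mixture of measures *)

Section integral_mixture.
Context {d d' : measure_display} {Y : measurableType d} {Z : measurableType d'}.
Context {R : realType}.
Variables (nu : {measure set Y -> \bar R}) (rho : {measure set Z -> \bar R}).
Variable k : Y -> {measure set Z -> \bar R}.
Hypothesis mk : forall E, measurable E -> measurable_fun [set: Y] (k ^~ E).
Hypothesis rhoE : forall E, measurable E -> rho E = (\int[nu]_y k y E)%E.

Import HBNNSimple.
Local Open Scope ereal_scope.

Lemma measurable_fun_mixture (f : Z -> \bar R) : (forall z, 0 <= f z) ->
  measurable_fun [set: Z] f -> measurable_fun [set: Y] (fun y => \int[k y]_z f z).
Proof. by move=> f0 mf; exact: measurable_fun_integral_kernel. Qed.

Let mixture_nnsfun (f : {nnsfun Z >-> R}) :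
  \int[rho]_z (f z)%:E = \int[nu]_y \int[k y]_z (f z)%:E.
Proof.
have fE (m : {measure set Z -> \bar R}) : \int[m]_z (f z)%:E =
    \sum_(r \in range f) r%:E * m (f @^-1` [set r]).
  by rewrite integralT_nnsfun sintegralE.
rewrite fE; under [RHS]eq_integral do rewrite fE.
rewrite ge0_integral_fsum//.
- apply: eq_fsbigr => r /set_mem[z _ <-].
  by rewrite ge0_integralZl ?lee_fin// ?rhoE//; exact: mk.
- by move=> r; apply: measurable_funeM; exact: mk.
- move=> r y _.
  have := mulemu_ge0 (fun n => f @^-1` [set n]).
  by apply; exact: preimage_nnfun0.
Qed.

(** Linearity settles simple functions and monotone convergence the rest. There are two uses: the
    edge measure, a mixture of the [m x] carried to slices, and a measure with a density, a mixture
    of weighted Dirac masses. *)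
Lemma integral_mixture (f : Z -> \bar R) : (forall z, 0 <= f z) ->
  measurable_fun [set: Z] f ->
  \int[rho]_z f z = \int[nu]_y \int[k y]_z f z.
Proof.
move=> f0 mf; pose f_ := nnsfun_approx measurableT mf.
have mf_ n : measurable_fun [set: Z] (fun z => (f_ n z)%:E).
  exact/measurable_EFinP.
have f_0 n z : 0 <= (f_ n z)%:E by rewrite lee_fin.
have ndf z : {homo (fun n => (f_ n z)%:E) : a b / (a <= b)%N >-> a <= b}.
  by move=> a b ab; rewrite lee_fin; exact/lefP/nd_nnsfun_approx.
have intE (m : {measure set Z -> \bar R}) :
    \int[m]_z f z = limn (fun n => \int[m]_z (f_ n z)%:E).
  rewrite -monotone_convergence//.
  by apply: eq_integral => z _; apply/esym/cvg_lim => //; exact: cvg_nnsfun_approx.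
rewrite intE; under [RHS]eq_integral do rewrite intE.
rewrite monotone_convergence//.
- by congr (limn _); apply/funext => n; exact: mixture_nnsfun.
- by move=> n; exact: measurable_fun_mixture.
- by move=> n y _; exact: integral_ge0.
- by move=> y _ a b ab; apply: ge0_le_integral => // z _; exact: ndf.
Qed.

End integral_mixture.

(** * The measure nu (x) m_x on the product and its symmetry *)

Section edge_measure.
Context {d : measure_display} {T : measurableType d} {R : realType}.
Variables (nu : {measure set T -> \bar R}) (m : R.-pker T ~> T).
Local Open Scope ereal_scope.

(** The measure N of the overview. Having it as a measure on the product, and not only as an
    iterated integral, gives access to dominated convergence and to images under the swap. *)
Definition edge (A : set (T * T)) : \bar R := \int[nu]_x m x (xsection A x).

Let measurable_edge A : measurable A ->
  measurable_fun [set: T] (fun x => m x (xsection A x)).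
Proof.
by move=> mA; apply: measurable_fun_xsection_finite_kernel; rewrite inE.
Qed.

Let edge0 : edge set0 = 0.
Proof. by apply: integral0_eq => x _; rewrite xsection0 measure0. Qed.

Let edge_ge0 A : 0 <= edge A. Proof. exact: integral_ge0. Qed.

Let edge_sigma_additive : semi_sigma_additive edge.
Proof.
move=> A mA tA mUA; rewrite [X in _ --> X](_ : _ =
    \int[nu]_x (\sum_(n <oo) m x (xsection (A n) x))); last first.
  apply: eq_integral => x _; rewrite xsection_bigcup.
  apply/esym/cvg_lim => //; apply: measure_semi_sigma_additive.
  - by move=> n; exact: measurable_xsection.
  - exact: trivIset_xsection.
  - by apply: bigcup_measurable => n _; exact: measurable_xsection.
apply/cvg_closeP; split.
  by apply: is_cvg_nneseries => n _ _; exact: integral_ge0.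
by rewrite closeE// integral_nneseries// => n; exact: measurable_edge.
Qed.

HB.instance Definition _ := isMeasure.Build _ _ _ edge
  edge0 edge_ge0 edge_sigma_additive.

Definition edge_measure : {measure set (T * T) -> \bar R} := edge.

(** The image of [m x] on the slice over [x]; the edge measure is the mixture of these. *)
Definition fiber (x : T) : {measure set (T * T) -> \bar R} :=
  measure_function_pushforward__canonical__measure_function_Measure
    (m x) (@pair1_measurable _ _ T T x).

Let fiberE x A : fiber x A = m x (xsection A x).
Proof.
by rewrite /= /pushforward; congr (m x _); apply/seteqP; split => y;
  rewrite /xsection /= inE.
Qed.

Let measurable_fiber A : measurable A -> measurable_fun [set: T] (fiber ^~ A).
Proof.
move=> mA; rewrite (_ : fiber ^~ A = fun x => m x (xsection A x)).
  exact: measurable_edge.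
by apply/funext => x; exact: fiberE.
Qed.

Let integral_fiber x (f : T * T -> \bar R) : (forall z, 0 <= f z) ->
  measurable_fun [set: T * T] f -> \int[fiber x]_z f z = \int[m x]_y f (x, y).
Proof.
move=> f0 mf.
by rewrite ge0_integral_pushforward// ?preimage_setT//; exact: pair1_measurable.
Qed.

Lemma edge_integral (f : T * T -> \bar R) : (forall z, 0 <= f z) ->
  measurable_fun [set: T * T] f ->
  \int[edge_measure]_z f z = \int[nu]_x \int[m x]_y f (x, y).
Proof.
move=> f0 mf; rewrite (@integral_mixture _ _ _ _ _ nu edge_measure fiber)//.
  by apply: eq_integral => x _; rewrite integral_fiber.
by move=> A mA; apply: eq_integral => x _; rewrite fiberE.
Qed.

Lemma measurable_fun_kernel_integral (f : T * T -> \bar R) :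
  (forall z, 0 <= f z) -> measurable_fun [set: T * T] f ->
  measurable_fun [set: T] (fun x => \int[m x]_y f (x, y)).
Proof. by move=> f0 mf; exact: measurable_fun_integral_finite_kernel. Qed.

Lemma edge_integral_fst (f : T -> \bar R) : (forall x, 0 <= f x) ->
  measurable_fun [set: T] f -> \int[edge_measure]_z f z.1 = \int[nu]_x f x.
Proof.
move=> f0 mf; rewrite edge_integral//; last exact: measurableT_comp.
apply: eq_integral => x _ /=.
by rewrite integral_cst// prob_kernel mule1.
Qed.

Hypothesis sfin : sigma_finite [set: T] nu.
Hypothesis rev : reversible m nu.

Lemma edge_rectangle A B : measurable A -> measurable B ->
  edge (A `*` B) = \int[nu]_(x in A) m x B.
Proof.
move=> mA mB; rewrite /edge [RHS]integral_mkcond; apply: eq_integral => x _.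
rewrite /patch; case: ifPn => xA; first by rewrite in_xsectionX.
by rewrite notin_xsectionX// measure0.
Qed.

Definition edge_swap : {measure set (T * T) -> \bar R} :=
  measure_function_pushforward__canonical__measure_function_Measure
    edge_measure (@measurable_swap _ _ T T).

(** Rectangles form a generating pi-system on which the two measures agree by reversibility. The
    exhaustion by [F i] times the whole space has finite measure because each [m x] is a
    probability. *)
Lemma edge_swapE A : measurable A -> edge_measure A = edge_swap A.
Proof.
move: A; case: sfin => F FT Ffin.
apply: (@measure_unique _ _ _ [set A `*` B | A in measurable & B in measurable]
  (fun i => F i `*` setT)).
- by rewrite measurable_prod_measurableType.
- move=> _ _ [X1 mX1 [X2 mX2 <-]] [Y1 mY1 [Y2 mY2 <-]].
  exists (X1 `&` Y1); first exact: measurableI.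
  by exists (X2 `&` Y2); [exact: measurableI|rewrite setXI].
- by move=> i; exists (F i); [case: (Ffin i)|exists setT].
- by rewrite -setX_bigcupl -FT setXTT.
- move=> _ [A mA [B mB <-]].
  rewrite /edge_swap /= /pushforward.
  have -> : swap @^-1` (A `*` B) = B `*` A.
    by apply/seteqP; split => -[x y] /= [].
  by rewrite !edge_rectangle// rev.
- move=> i; rewrite /edge_measure /= edge_rectangle//; last by case: (Ffin i).
  rewrite (eq_integral (cst 1)); last by move=> x _; rewrite prob_kernel.
  by rewrite integral_cst// ?mul1e; case: (Ffin i).
Qed.

Lemma edge_integral_swap (f : T * T -> \bar R) : (forall z, 0 <= f z) ->
  measurable_fun [set: T * T] f ->
  \int[edge_measure]_z f (swap z) = \int[edge_measure]_z f z.
Proof.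
move=> f0 mf; rewrite [RHS](eq_measure_integral edge_swap); last first.
  by move=> A mA _; exact: edge_swapE.
by rewrite ge0_integral_pushforward// ?preimage_setT//; exact: measurable_swap.
Qed.

Lemma edge_integral_snd (f : T -> \bar R) : (forall x, 0 <= f x) ->
  measurable_fun [set: T] f -> \int[edge_measure]_z f z.2 = \int[nu]_x f x.
Proof.
move=> f0 mf; rewrite -edge_integral_fst//.
rewrite -(edge_integral_swap (f := fun z => f z.2))//.
exact: measurableT_comp.
Qed.

End edge_measure.

(** * Fubini and integration by parts on edges *)

Section edge_real.
Context {d : measure_display} {T : measurableType d} {R : realType}.
Variables (nu : {measure set T -> \bar R}) (m : R.-pker T ~> T).
Hypothesis sfin : sigma_finite [set: T] nu.
Hypothesis rev : reversible m nu.
Local Notation N := (edge_measure nu m).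

(** For [G = sgpow p (grad u)] this is Delta_p u. Where the section of a measurable [G] is not
    integrable the value defaults to 0; by [edge_ae_Lint] this is a null set once [G] is
    integrable. *)
Definition kint (G : T * T -> R) (x : T) : R :=
  Rintegral (m x) [set: T] (fun y => G (x, y)).

Lemma Lint_edge_fst f : Lint nu f -> Lint N (fun z => f z.1).
Proof.
move=> lf; have mf := Lint_measurable lf; apply/integrableP; split.
  by apply/measurable_EFinP; exact: measurableT_comp.
rewrite (edge_integral_fst nu m (f := fun x => (`|f x|)%:E))//.
  exact: Lint_lty.
by apply/measurable_EFinP; exact: measurableT_comp.
Qed.

Lemma Lint_edge_snd f : Lint nu f -> Lint N (fun z => f z.2).
Proof.
move=> lf; have mf := Lint_measurable lf; apply/integrableP; split.
  by apply/measurable_EFinP; exact: measurableT_comp.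
rewrite (edge_integral_snd sfin rev (f := fun x => (`|f x|)%:E))//.
  exact: Lint_lty.
by apply/measurable_EFinP; exact: measurableT_comp.
Qed.

Lemma RI_edge_fst f : Lint nu f -> (forall x, 0 <= f x) ->
  RI N (fun z => f z.1) = RI nu f.
Proof.
move=> /Lint_measurable mf f0; rewrite /RI /Rintegral; congr fine.
rewrite (edge_integral_fst nu m (f := fun x => (f x)%:E))//.
exact/measurable_EFinP.
Qed.

Lemma RI_edge_snd f : Lint nu f -> (forall x, 0 <= f x) ->
  RI N (fun z => f z.2) = RI nu f.
Proof.
move=> /Lint_measurable mf f0; rewrite /RI /Rintegral; congr fine.
rewrite (edge_integral_snd sfin rev (f := fun x => (f x)%:E))//.
exact/measurable_EFinP.
Qed.

Lemma Lint_swap G : Lint N G -> Lint N (fun z => G (swap z)).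
Proof.
move=> lG; have mG := Lint_measurable lG; apply/integrableP; split.
  by apply/measurable_EFinP; apply: measurableT_comp => //; exact: measurable_swap.
rewrite (edge_integral_swap sfin rev (f := fun z => (`|G z|)%:E))//.
  exact: Lint_lty.
by apply/measurable_EFinP; exact: measurableT_comp.
Qed.

Lemma RI_swap G : Lint N G -> RI N (fun z => G (swap z)) = RI N G.
Proof.
move=> lG; have mG := Lint_measurable lG.
rewrite /RI /Rintegral; congr fine.
rewrite [RHS](eq_measure_integral (edge_swap nu m)); last first.
  by move=> A mA _; exact: edge_swapE.
apply/esym; apply: (@integral_pushforward _ _ _ _ _ swap _ N setT (EFin \o G)) => //.
- exact: measurable_swap.
- exact/measurable_EFinP.
- exact: Lint_swap lG.
Qed.

Lemma measurable_kint G : measurable_fun [set: T * T] G ->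
  measurable_fun [set: T] (kint G).
Proof.
move=> mG; rewrite (_ : kint G = fine \o (fun x =>
    \int[m x]_y (EFin \o G)^\+ (x, y) - \int[m x]_y (EFin \o G)^\- (x, y))%E).
2: apply/funext => x; rewrite /kint /Rintegral integralE /=.
2: by congr (fine (_ - _)%E); apply: eq_integral => y _; rewrite !unlock.
apply: measurableT_comp => //.
apply: emeasurable_funB.
- apply: (measurable_fun_kernel_integral m (f := (EFin \o G)^\+%E)) => //.
  exact/measurable_funepos/measurable_EFinP.
- apply: (measurable_fun_kernel_integral m (f := (EFin \o G)^\-%E)) => //.
  exact/measurable_funeneg/measurable_EFinP.
Qed.

Lemma kint_norm_le G x : measurable_fun [set: T * T] G ->
  ((`|kint G x|)%:E <= \int[m x]_y (`|G (x, y)|)%:E)%E.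
Proof.
move=> mG; have mGx : measurable_fun [set: T] (fun y => (G (x, y))%:E).
  by apply/measurable_EFinP; exact: measurable_fun_pair2.
apply: le_trans (le_abse_integral (m x) measurableT mGx).
rewrite /kint /Rintegral; move: (integral _ _ _) => [r| |] /=; by rewrite ?leey.
Qed.

Lemma edge_ae_Lint G : Lint N G ->
  {ae nu, forall x, Lint (m x) (fun y => G (x, y))}.
Proof.
move=> lG; have mG := Lint_measurable lG.
have mg : measurable_fun [set: T * T] (fun z => (`|G z|)%:E).
  by apply/measurable_EFinP; exact: measurableT_comp.
have : nu.-integrable [set: T] (fun x => \int[m x]_y (`|G (x, y)|)%:E)%E.
  apply/integrableP; split.
    exact: (measurable_fun_kernel_integral m (f := fun z => (`|G z|)%:E)).
  under eq_integral do rewrite gee0_abs ?integral_ge0//.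
  by rewrite -(edge_integral nu m (f := fun z => (`|G z|)%:E))//; exact: Lint_lty.
move=> /(integrable_ae measurableT); apply: filterS => x /(_ I) fx.
apply/integrableP; split.
  by apply/measurable_EFinP; exact: measurable_fun_pair2.
by move: fx; rewrite ge0_fin_numE ?integral_ge0.
Qed.

Lemma Lint_kint G : Lint N G -> Lint nu (kint G).
Proof.
move=> lG; have mG := Lint_measurable lG.
have mg : measurable_fun [set: T * T] (fun z => (`|G z|)%:E).
  by apply/measurable_EFinP; exact: measurableT_comp.
apply/integrableP; split; first exact/measurable_EFinP/measurable_kint.
apply: le_lt_trans (Lint_lty lG).
rewrite (edge_integral nu m (f := fun z => (`|G z|)%:E))//.
apply: ge0_le_integral => //.
- apply: measurableT_comp => //.
  exact/measurable_EFinP/measurable_kint.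
- exact: (measurable_fun_kernel_integral m (f := fun z => (`|G z|)%:E)).
- by move=> x _; exact: kint_norm_le.
Qed.

Lemma RI_edge_ge0 G : Lint N G -> (forall z, 0 <= G z) ->
  RI N G = RI nu (kint G).
Proof.
move=> lG G0; have mG := Lint_measurable lG.
apply: EFin_inj; rewrite -!EFin_RI//; last exact: Lint_kint.
rewrite (edge_integral nu m (f := fun z => (G z)%:E))//; last exact/measurable_EFinP.
apply: ge0_ae_eq_integral => //.
- apply: (measurable_fun_kernel_integral m (f := fun z => (G z)%:E)) => //.
  exact/measurable_EFinP.
- exact/measurable_EFinP/measurable_kint.
- by move=> x _; apply: integral_ge0 => y _; rewrite lee_fin.
- by move=> x _; rewrite lee_fin; apply: Rintegral_ge0 => y _.
apply: filterS (edge_ae_Lint lG) => x lx _.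
by rewrite EFin_RI.
Qed.

Lemma RI_edge G : Lint N G -> RI N G = RI nu (kint G).
Proof.
move=> lG; have mG := Lint_measurable lG.
(* A signed [G] is the difference of the nonnegative functions [P] and [Q]. *)
pose P z := `|G z| + G z; pose Q z := `|G z|.
have lQ : Lint N Q by exact: Lint_norm.
have lP : Lint N P by exact: LintD.
have -> : RI N G = RI N P - RI N Q.
  by rewrite -RI_B//; congr RI; apply/funext => z; rewrite /P /Q; ring.
rewrite (RI_edge_ge0 lP); last first.
  by move=> z; rewrite /P; have := ler_norm (- G z); rewrite normrN; lra.
rewrite (RI_edge_ge0 lQ); last by move=> z; exact: normr_ge0.
rewrite -RI_B; [|exact: Lint_kint..].
apply: RI_ae_eq.
- by apply: measurable_funB; apply: measurable_kint;
    [exact: Lint_measurable lP|exact: Lint_measurable lQ].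
- exact: measurable_kint.
apply: filterS2 (edge_ae_Lint lP) (edge_ae_Lint lQ) => x lPx lQx.
rewrite /kint -[LHS]RI_B//; congr RI; apply/funext => y; rewrite /P /Q; ring.
Qed.

(** Integrability is asked of the product because in the integration by parts only [G] times the
    test function is integrable. For [c = 0] the section of [G] may have no integral, and both sides
    are 0. *)
Lemma kintZ (c : R) G x : Lint (m x) (fun y => c * G (x, y)) ->
  kint (fun z => c * G z) x = c * kint G x.
Proof.
move=> lx; rewrite /kint; have [->|c0] := eqVneq c 0.
  rewrite mul0r; transitivity (RI (m x) (fun=> 0)).
    by congr RI; apply/funext => y; rewrite mul0r.
  by rewrite /RI Rintegral_cst// mul0r.
rewrite -[LHS]/(RI (m x) (fun y => c * G (x, y))) -RI_Z//.
have := LintZ c^-1 lx; apply: Lint_eq => y.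
by rewrite mulrA mulVf// mul1r.
Qed.

(* Symmetrizing the edge measure moves the gradient off the test function. *)
Lemma RI_edge_antisym (G : T * T -> R) (phi : T -> R) : measurable_fun [set: T * T] G ->
  (forall z, G (swap z) = - G z) -> Lint N (fun z => G z * phi z.1) ->
  measurable_fun [set: T] phi ->
  Lint nu (fun x => phi x * kint G x) /\
  RI N (fun z => G z * (phi z.2 - phi z.1)) = - 2 * RI nu (fun x => phi x * kint G x).
Proof.
move=> mG aG lH mphi; set H := (fun z => _) in lH.
have mH := Lint_measurable lH.
have mK : measurable_fun [set: T] (fun x => phi x * kint G x).
  by apply: measurable_funM => //; exact: measurable_kint.
have HK : {ae nu, forall x, phi x * kint G x = kint H x}.
  apply: filterS (edge_ae_Lint lH) => x lx.
  rewrite -kintZ; last by apply: Lint_eq lx => y; rewrite /H mulrC.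
  by rewrite /kint; congr Rintegral; apply/funext => y; rewrite /H mulrC.
split; first by apply: Lint_ae_eq HK => //; exact: Lint_kint.
rewrite (RI_ae_eq _ _ HK)//; last exact: measurable_kint.
rewrite -RI_edge//.
(* By antisymmetry [H (swap z) = - G z * phi z.2], so both halves of the gradient contribute the
   same [- RI N H]. *)
transitivity (RI N (fun z => - H (swap z) - H z)).
  by congr RI; apply/funext => -[x y]; rewrite /H aG /=; ring.
have lS := Lint_swap lH.
rewrite RI_B//; last exact: LintN.
by rewrite RI_N// RI_swap//; ring.
Qed.

End edge_real.

(** * Inequalities for |t|^p and its derivative *)

Section signed_power.
Context {R : realType} (p : R).
Hypothesis p1 : 1 < p.
Implicit Types a b s t : R.

Let p0 : 0 < p. Proof. exact: lt_trans p1. Qed.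
Let pB0 : 0 < p - 1. Proof. by rewrite subr_gt0. Qed.

Lemma sgpowN t : sgpow p (- t) = - sgpow p t.
Proof. by rewrite /sgpow sgrN normrN mulNr. Qed.

Lemma sgpow_mul t : sgpow p t * t = `|t| `^ p.
Proof.
by rewrite /sgpow mulrAC -normrEsg mulr_powRB1.
Qed.

Lemma normr_sgpow t : `|sgpow p t| = `|t| `^ (p - 1).
Proof.
rewrite /sgpow normrM normr_sg (ger0_norm (powR_ge0 _ _)).
have [->|t0] := eqVneq t 0; last by rewrite mul1r.
by rewrite normr0 powR0 ?gt_eqF// mulr0.
Qed.

(** A crude Young inequality: the left side is at most the p-th power of the larger of [|a|] and
    [|s|]. It is the domination for every pairing of |grad u|^(p-1) with a test gradient. *)
Lemma sgpow_young a s : `|sgpow p a * s| <= `|a| `^ p + `|s| `^ p.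
Proof.
rewrite normrM normr_sgpow.
have [sa|/ltW as_] := leP `|s| `|a|.
  rewrite (@le_trans _ _ (`|a| `^ p))//; last by rewrite lerDl powR_ge0.
  rewrite -[in leRHS](@mulr_powRB1 _ `|a| p)// [leRHS]mulrC.
  by rewrite ler_wpM2l// powR_ge0.
rewrite (@le_trans _ _ (`|s| `^ p))//; last by rewrite lerDr powR_ge0.
rewrite -[in leRHS](@mulr_powRB1 _ `|s| p)// [leRHS]mulrC ler_wpM2r//.
by apply: ge0_ler_powR; rewrite ?nnegrE// ltW.
Qed.

Lemma powR_tangent a b : `|a| `^ p + p * (sgpow p a * (b - a)) <= `|b| `^ p.
Proof.
have q0 : 0 < p / (p - 1) by rewrite divr_gt0.
have := @conjugate_powR R `|b| (`|a| `^ (p - 1)) p (p / (p - 1))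
  (normr_ge0 _) (powR_ge0 _ _) p0 q0.
have -> : p^-1 + (p / (p - 1))^-1 = 1.
  by field; rewrite !gt_eqF.
move=> /(_ erefl); rewrite -powRrM.
have -> : (p - 1) * (p / (p - 1)) = p by field; rewrite gt_eqF.
set A := `|a| `^ p; set B := `|b| `^ p => H.
have H1 : p * (sgpow p a * b) <= B + (p - 1) * A.
  have -> : B + (p - 1) * A = p * (B / p + A / (p / (p - 1))).
    by field; rewrite !gt_eqF.
  rewrite ler_pM2l//; apply: le_trans H.
  by rewrite (le_trans (ler_norm _))// normrM normr_sgpow mulrC.
rewrite mulrBr sgpow_mul mulrBr -/A; lra.
Qed.

(** Adding the tangent inequalities at [a] and at [b] gives monotonicity of the derivative. *)
Lemma sgpow_homo a b : a <= b -> sgpow p a <= sgpow p b.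
Proof.
rewrite le_eqVlt => /predU1P[->//|ab].
have ha := powR_tangent a b; have hb := powR_tangent b a.
have h : p * ((sgpow p a - sgpow p b) * (b - a)) <= 0 by nra.
rewrite pmulr_rle0// pmulr_lle0 ?subr_gt0// in h.
by rewrite -subr_le0.
Qed.

Lemma measurable_sgpow : measurable_fun [set: R] (sgpow p).
Proof. by apply: nondecreasing_measurable => // x y; exact: sgpow_homo. Qed.

Lemma powRD_le a b : `|a + b| `^ p <= 2 `^ p * (`|a| `^ p + `|b| `^ p).
Proof.
have p0' : 0 <= p by exact: ltW.
wlog ab : a b / `|a| <= `|b|.
  move=> H; have [/H//|/ltW/H] := leP `|a| `|b|.
  by rewrite addrC [X in _ * X]addrC.
rewrite (@le_trans _ _ ((2 * `|b|) `^ p))//.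
  apply: ge0_ler_powR; rewrite ?nnegrE ?mulr_ge0//.
  by rewrite (le_trans (ler_normD _ _))// mulrDl !mul1r lerD2r.
by rewrite powRM// ler_wpM2l ?powR_ge0// lerDr powR_ge0.
Qed.

Lemma sgpow_continuous : continuous (sgpow p).
Proof.
have pos t : 0 < t -> {for t, continuous (sgpow p)}.
  move=> t0; have : {for t, continuous (@powR R ^~ (p - 1))}.
    apply: differentiable_continuous; apply/derivable1_diffP.
    by apply: derivable_powR; rewrite in_itv/= t0.
  move=> H; suff : sgpow p x @[x --> t] --> sgpow p t by [].
  have -> : sgpow p t = t `^ (p - 1) by rewrite /sgpow gtr0_sg// gtr0_norm// mul1r.
  apply: cvg_trans H; apply: near_eq_cvg; near=> x.
  have x0 : 0 < x by near: x; exact: lt_nbhsr.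
  by rewrite /sgpow gtr0_sg// gtr0_norm// mul1r.
move=> t; have [t0|t0|<-] := ltgtP 0 t; first exact: pos.
  have -> : sgpow p = (fun x => - sgpow p (- x)).
    by apply/funext => x; rewrite sgpowN opprK.
  apply: cvgN; apply: continuous_comp; first exact: opp_continuous.
  by apply: pos; rewrite oppr_gt0.
suff : sgpow p x @[x --> (0 : R)] --> sgpow p 0 by [].
rewrite [X in _ --> X](_ : _ = 0); last by rewrite /sgpow sgr0 mul0r.
apply/cvgrPdist_lt => e e0; near=> x; rewrite sub0r normrN normr_sgpow.
(* The radius around 0 is e^(1/(p-1)), available because p > 1. *)
have -> : e = (e `^ (p - 1)^-1) `^ (p - 1).
  by rewrite -powRrM mulVf ?gt_eqF// powRr1// ltW.
apply: gt0_ltr_powR; rewrite ?nnegrE// ?powR_ge0//.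
near: x; apply/nbhs_ballP; exists (e `^ (p - 1)^-1); first exact: powR_gt0.
by move=> y; rewrite /ball/= sub0r normrN.
Unshelve. all: by end_near. Qed.

(** Either a^(p-1) <= alpha/2, which gives the first term, or alpha < 2 a^(p-1). In the latter case
    a^p dominates: by alpha <= 1 when a >= 1, and by a^(2(p-1)) <= a^p when a <= 1, which is where
    [2 <= p] enters. *)
Lemma mul_powR_le a alpha : 2 <= p -> 0 <= a -> 0 <= alpha <= 1 ->
  alpha * a `^ (p - 1) <= alpha ^+ 2 / 2 + 2 * a `^ p.
Proof.
move=> p2 a0 /andP[al0 al1].
have ap0 : 0 <= a `^ p by exact: powR_ge0.
have h0 : 0 <= a `^ (p - 1) by exact: powR_ge0.
have [hal|hal] := leP (a `^ (p - 1)) (alpha / 2).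
  by rewrite expr2; nra.
have agt0 : 0 < a.
  apply: (@gt0_powR _ a (p - 1)) => //.
  by apply: le_lt_trans hal; rewrite divr_ge0.
have aE : a * a `^ (p - 1) = a `^ p by exact: mulr_powRB1.
have [a1|/ltW a1] := leP 1 a; first by rewrite -aE expr2; nra.
have : a `^ (p - 1) * a `^ (p - 1) <= a `^ p.
  rewrite -powRD; last by rewrite (gt_eqF agt0) implybT.
  by apply: ger_powR; [rewrite agt0|lra].
by rewrite expr2; nra.
Qed.

End signed_power.

(** * Moreau-Yosida regularization on the line *)

Section moreau_yosida.
Context {R : realType} (j : R -> \bar R).
Hypothesis j_convex : convex_ext j.
Hypothesis j_lsc : lower_semicontinuous j.
Hypothesis j_ge0 : forall t, (0 <= j t)%E.
Hypothesis j00 : j 0 = 0%E.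
Implicit Types a b k : R.

(** The parameter [k] is the inverse of the usual one, so the envelopes increase to [j] as [k]
    grows. *)
Definition prox_cost k a b : \bar R := (j b + (k / 2 * (a - b) ^+ 2)%:E)%E.

(** A minimizing sequence is bounded by the quadratic term; lower semicontinuity shows that the
    limit of a convergent subsequence is a minimizer. The infimum is finite because [j 0 = 0]. *)
Lemma prox_exists k a : 0 < k ->
  exists P, forall b, (prox_cost k a P <= prox_cost k a b)%E.
Proof.
move=> k0; pose S := range (prox_cost k a).
have g0 b : 0 <= k / 2 * (a - b) ^+ 2 by rewrite mulr_ge0 ?sqr_ge0 ?divr_ge0// ltW.
have S0 : (0 <= ereal_inf S)%E.
  by apply: le_ereal_inf_tmp => _ [b _ <-]; rewrite adde_ge0 ?lee_fin.
have Sfin : ereal_inf S \is a fin_num.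
  rewrite ge0_fin_numE//; apply: (@le_lt_trans _ _ (prox_cost k a 0)).
    by apply: ereal_inf_lbound; exists 0.
  by rewrite /prox_cost j00 add0e ltry.
have [r Sr] : exists r, ereal_inf S = r%:E by exists (fine (ereal_inf S)); rewrite fineK.
have Hb (n : nat) : exists b, (prox_cost k a b < (r + n.+1%:R^-1)%:E)%E.
  have n0 : (0 : R) < n.+1%:R^-1 by rewrite invr_gt0.
  have [_ [b _ <-] h] := lb_ereal_inf_adherent n0 Sfin.
  by exists b; rewrite EFinD -Sr.
have [u Hu] := choice Hb.
have bu : bounded_fun u.
  exists (`|a| + (2 * (r + 1) / k + 1)); split; first exact: num_real.
  move=> M /ltW MM n _; apply: le_trans MM.
  have : k / 2 * (a - u n) ^+ 2 <= r + 1.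
    rewrite -lee_fin; apply: (@le_trans _ _ (prox_cost k a (u n))).
      by rewrite leeDr.
    apply: ltW; apply: lt_le_trans (Hu n) _; rewrite lee_fin lerD2l.
    by rewrite invf_le1// ler1n.
  move=> h; have h2 : (a - u n) ^+ 2 <= 2 * (r + 1) / k.
    rewrite ler_pdivlMr// mulrC; lra.
  have h3 : `|a - u n| <= 2 * (r + 1) / k + 1.
    rewrite -real_normK ?num_real// in h2; have := normr_ge0 (a - u n).
    by move: h2; set z := `|a - u n|; have := sqr_ge0 (z - 1); nra.
  have -> : u n = a - (a - u n) by ring.
  by rewrite (le_trans (ler_normB _ _))// lerD2l.
have [f fincr] := bolzano_weierstrass bu.
move=> /cvg_ex[P /= uP]; exists P => b.
suff : (prox_cost k a P <= r%:E)%E.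
  by move=> h; rewrite (le_trans h)// -Sr; apply: ereal_inf_lbound; exists b.
rewrite leNgt; apply/negP => hP.
pose g b := k / 2 * (a - b) ^+ 2.
have [c [rc cP]] : exists c : R, r < c /\ (c%:E < prox_cost k a P)%E.
  move: hP; case: (prox_cost k a P) => [s| |] //.
  - rewrite lte_fin => rs; exists ((r + s) / 2); rewrite lte_fin; lra.
  - by move=> _; exists (r + 1); rewrite ltry; split => //; lra.
(* The gap between [c] and [c'] pays for the error in the quadratic term [g], while the gap between
   [r] and [c] contradicts minimization along the subsequence. *)
have [c' [cc' jP]] : exists c' : R, c < c' /\ ((c' - g P)%:E < j P)%E.
  move: cP; rewrite /prox_cost -/(g P); case: (j P) (j_ge0 P) => [s| |] //.
  - move=> _; rewrite -EFinD lte_fin => rs.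
    by exists ((c + (s + g P)) / 2); rewrite lte_fin; split; lra.
  - by move=> _ _; exists (c + 1); rewrite ltry; split => //; lra.
have [V VP HV] := j_lsc jP.
have cg : g (u (f n)) @[n --> \oo] --> g P.
  have -> : g = (fun b => k / 2 * ((a - b) * (a - b))).
    by apply/funext => x; rewrite /g expr2.
  apply: cvgM; first exact: cvg_cst.
  by apply: cvgM; apply: cvgB => //; exact: cvg_cst.
have cr : 0 < c - r by rewrite subr_gt0.
have : \forall n \near \oo, False; last by move=> /filter_ex[].
near=> n.
have h1 : V (u (f n)) by near: n; exact: uP.
have h2 : g P - (c' - c) / 2 < g (u (f n)).
  by near: n; apply: (cvgr_gt (g P)) => //; lra.
have h3 : n.+1%:R^-1 < c - r.
  by near: n; exact: (near_infty_natSinv_lt (PosNum cr)).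
have h4 : ((f n).+1%:R^-1 : R) <= n.+1%:R^-1.
  by rewrite lef_pV2 ?posrE// ler_nat ltnS; exact: mono_leq_infl.
have := Hu (f n); have := HV _ h1; rewrite /prox_cost -/(g (u (f n))).
case: (j (u (f n))) => [s| |] //.
rewrite -EFinD !lte_fin; move: h2 h3 h4 (cc').
move: (g P) (g (u (f n))) ((f n).+1%:R^-1 : R) (n.+1%:R^-1 : R) => gP gu i1 i2; lra.
Unshelve. all: by end_near. Qed.

Definition prox k a : R :=
  if pselect (0 < k) is left k0 then projT1 (cid (prox_exists a k0)) else 0.

Section fixed_parameter.
Variable k : R.
Hypothesis k0 : 0 < k.

Lemma prox_min a b : (prox_cost k a (prox k a) <= prox_cost k a b)%E.
Proof.
by rewrite {1}/prox; case: pselect => // ?; case: cid => P hP; exact: hP.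
Qed.

Lemma prox_fin a : j (prox k a) \is a fin_num.
Proof.
rewrite ge0_fin_numE//; apply: (@le_lt_trans _ _ (prox_cost k a 0)).
  apply: le_trans (prox_min a 0); rewrite leeDl// lee_fin.
  by rewrite mulr_ge0 ?sqr_ge0 ?divr_ge0// ltW.
by rewrite /prox_cost j00 add0e ltry.
Qed.

(** The Yosida approximation, which acts as the derivative of the envelope through
    [envelope_subgradient]. *)
Definition yosida a : R := k * (a - prox k a).

Definition envelope a : R := fine (j (prox k a)) + k / 2 * (a - prox k a) ^+ 2.

Lemma envelopeE a : (envelope a)%:E = prox_cost k a (prox k a).
Proof. by rewrite /envelope EFinD fineK// prox_fin. Qed.

Lemma envelope_ge0 a : 0 <= envelope a.
Proof. by rewrite addr_ge0 ?fine_ge0// mulr_ge0 ?sqr_ge0 ?divr_ge0// ltW. Qed.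

Lemma envelope_le a : ((envelope a)%:E <= j a)%E.
Proof.
rewrite envelopeE (le_trans (prox_min a a))// /prox_cost subrr expr0n mulr0.
by rewrite adde0.
Qed.

Lemma envelope_le_sqr a : envelope a <= k / 2 * a ^+ 2.
Proof.
rewrite -lee_fin envelopeE (le_trans (prox_min a 0))//.
by rewrite /prox_cost j00 add0e subr0.
Qed.

(** The optimality condition at the minimizer, obtained by comparing it with points of the segment
    towards [b]. *)
Lemma prox_subgradient a b :
  (j (prox k a) + (yosida a * (b - prox k a))%:E <= j b)%E.
Proof.
set P := prox k a; have Pfin := prox_fin a; rewrite -/P in Pfin.
have [jb|] := boolP (j b \is a fin_num); last first.
  by rewrite ge0_fin_numE// -leNgt leye_eq => /eqP ->; rewrite leey.
rewrite -(fineK Pfin) -(fineK jb) -EFinD lee_fin.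
set J := fine (j P); set B := fine (j b); rewrite /yosida -/P leNgt; apply/negP => h.
set D := J + k * (a - P) * (b - P) - B.
have D0 : 0 < D by rewrite /D; lra.
pose e := k * (b - P) ^+ 2.
have e0 : 0 <= e by rewrite mulr_ge0 ?sqr_ge0// ltW.
(* A fixed [t] replaces the limit t -> 0. The comparison yields D <= t e / 2, whereas t (D + e) = D
   gives t e < D. *)
pose t := D / (D + e).
have De : 0 < D + e by lra.
have t0 : 0 < t by rewrite divr_gt0.
have t1 : t <= 1 by rewrite ler_pdivrMr// mul1r; lra.
have tDe : t * (D + e) = D by rewrite /t mulfVK// gt_eqF.
have := prox_min a (t * b + (1 - t) * P); rewrite -/P /prox_cost => H.
have t01 : 0 <= t <= 1 by rewrite t1 ltW.
have := le_trans H (leeD2r _ (j_convex b P t01)).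
rewrite -(fineK Pfin) -(fineK jb) -/J -/B -!EFinM -!EFinD lee_fin.
have -> : a - (t * b + (1 - t) * P) = (a - P) - t * (b - P) by ring.
have : t * D = t * (J + k * (a - P) * (b - P) - B) by [].
have : e = k * (b - P) ^+ 2 by [].
move: (a - P) (b - P) => x y eE DE K.
have K2 : t * D <= t * (t * e / 2).
  rewrite DE eE; move: K; rewrite !expr2; lra.
rewrite ler_pM2l// in K2.
have := mulr_gt0 t0 D0; move: tDe; rewrite mulrDr; lra.
Qed.

(** With P and Q the proximal points of a and b, [prox_subgradient] at Q leaves over exactly the
    square k/2 ((a - P) - (b - Q))^2. *)
Lemma envelope_subgradient a b :
  envelope a + yosida a * (b - a) <= envelope b.
Proof.
have := prox_subgradient a (prox k b).
rewrite -(fineK (prox_fin a)) -(fineK (prox_fin b)) -EFinD lee_fin.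
rewrite /envelope /yosida; set P := prox k a; set Q := prox k b.
move=> h.
have : 0 <= k / 2 * ((a - P) - (b - Q)) ^+ 2.
  by rewrite mulr_ge0 ?sqr_ge0 ?divr_ge0// ltW.
move: h; rewrite !expr2; lra.
Qed.

(** Adding the two optimality conditions shows that the increments of [yosida] and of [prox] have a
    nonnegative product; then [prox] is expressed through [yosida]. Monotonicity and the Lipschitz
    bound both follow from this cocoercivity. *)
Lemma yosida_firm a b :
  (yosida b - yosida a) ^+ 2 <= k * ((yosida b - yosida a) * (b - a)).
Proof.
have := prox_subgradient a (prox k b); have := prox_subgradient b (prox k a).
rewrite -(fineK (prox_fin a)) -(fineK (prox_fin b)) -!EFinD !lee_fin.
have -> : prox k b - prox k a = (b - a) - (yosida b - yosida a) / k.
  by rewrite /yosida; field; rewrite gt_eqF.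
have -> : prox k a - prox k b = - ((b - a) - (yosida b - yosida a) / k).
  by rewrite /yosida; field; rewrite gt_eqF.
move: (yosida a) (yosida b) (fine _) (fine _) (b - a) => x y A B z h1 h2.
have : 0 <= (y - x) * (z - (y - x) / k) by lra.
rewrite -(pmulr_rge0 _ k0).
have -> : k * ((y - x) * (z - (y - x) / k)) = k * ((y - x) * z) - (y - x) ^+ 2.
  by field; rewrite gt_eqF.
by rewrite subr_ge0.
Qed.

Lemma yosida_homo a b : a <= b -> yosida a <= yosida b.
Proof.
rewrite le_eqVlt => /predU1P[->//|ab].
have := le_trans (sqr_ge0 _) (yosida_firm a b).
by rewrite pmulr_rge0// pmulr_lge0 ?subr_gt0// subr_ge0.
Qed.

Lemma yosida_lipschitz a b : `|yosida b - yosida a| <= k * `|b - a|.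
Proof.
have := yosida_firm a b; set y := yosida b - yosida a; set z := b - a.
rewrite -real_normK ?num_real// => h.
have : `|y| * `|y| <= `|y| * (k * `|z|).
  rewrite -expr2 (le_trans h)// [leRHS]mulrCA ler_pM2l//.
  by rewrite (le_trans (ler_norm _))// normrM.
have [y0|y0] := eqVneq `|y| 0; first by rewrite y0 mulr_ge0// ltW.
by rewrite ler_pM2l// lt_neqAle eq_sym y0 normr_ge0.
Qed.

Lemma yosida0 : yosida 0 = 0.
Proof.
have := envelope_le_sqr 0; rewrite expr0n mulr0 /envelope.
have := fine_ge0 (j_ge0 (prox k 0)); rewrite sub0r sqrrN => h1 h2.
have : k / 2 * prox k 0 ^+ 2 <= 0 by lra.
rewrite pmulr_rle0 ?divr_gt0// => h3.
have /eqP : prox k 0 ^+ 2 = 0 by apply/eqP; rewrite eq_le h3 sqr_ge0.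
by rewrite expf_eq0 /= /yosida => /eqP ->; rewrite subr0 mulr0.
Qed.

Lemma envelope0 : envelope 0 = 0.
Proof.
apply/eqP; rewrite eq_le envelope_ge0 andbT (le_trans (envelope_le_sqr 0))//.
by rewrite expr0n mulr0.
Qed.

(** The envelope is monotone on each side of 0, where [yosida] has a constant sign, hence a sum of
    two monotone functions. *)
Lemma measurable_envelope : measurable_fun [set: R] envelope.
Proof.
have nd a b : 0 <= a -> a <= b -> envelope a <= envelope b.
  move=> a0 ab; rewrite (le_trans _ (envelope_subgradient a b))// lerDl.
  by rewrite mulr_ge0 ?subr_ge0// -yosida0 yosida_homo.
have ni a b : b <= 0 -> a <= b -> envelope b <= envelope a.
  move=> b0 ab; rewrite (le_trans _ (envelope_subgradient b a))// lerDl.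
  by rewrite mulr_le0 ?subr_le0// -yosida0 yosida_homo.
have -> : envelope = (fun a => envelope (Num.max a 0) + envelope (Num.min a 0)).
  apply/funext => a; have [a0|a0] := leP a 0.
    by rewrite envelope0 add0r.
  by rewrite envelope0 addr0.
apply: measurable_funD.
- apply: nondecreasing_measurable => // a b ab; apply: nd.
    by rewrite le_max lexx orbT.
  by rewrite ge_max !le_max ab lexx orbT.
- apply: nonincreasing_measurable => // a b ab; apply: ni.
    by rewrite ge_min lexx orbT.
  by rewrite le_min !ge_min ab lexx orbT.
Qed.

End fixed_parameter.

Lemma envelope_le_param k l a : 0 < k -> k <= l -> envelope k a <= envelope l a.
Proof.
move=> k0 kl; have l0 : 0 < l by exact: lt_le_trans kl.
rewrite -lee_fin !envelopeE// (le_trans (prox_min k0 a (prox l a)))//.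
by rewrite /prox_cost leeD2l// lee_fin ler_wpM2r ?sqr_ge0// ler_wpM2r.
Qed.

(** Suppose the envelopes stay below some c < j a. If the proximal point is close to a,
    semicontinuity makes j exceed c there; if it is at distance at least e, the quadratic term does
    so once n + 1 > 2c/e^2. *)
Lemma envelope_cvg a : (envelope n.+1%:R a)%:E @[n --> \oo] --> j a.
Proof.
have nS0 (n : nat) : 0 < n.+1%:R :> R by [].
have nd : nondecreasing_seq (fun n : nat => (envelope n.+1%:R a)%:E).
  by move=> n l nl; rewrite lee_fin envelope_le_param// ler_nat ltnS.
suff -> : j a = ereal_sup (range (fun n : nat => (envelope n.+1%:R a)%:E)).
  exact: ereal_nondecreasing_cvgn.
apply/eqP; rewrite eq_le; apply/andP; split; last first.
  by apply: ge_ereal_sup => _ [n _ <-]; exact: envelope_le.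
rewrite leNgt; apply/negP => h.
have [c [hc cj]] : exists c : R,
    (ereal_sup (range (fun n : nat => (envelope n.+1%:R a)%:E)) <= c%:E)%E /\
    (c%:E < j a)%E.
  move: h; set S := ereal_sup _; have : (0 <= S)%E.
    apply: ereal_sup_ge; exists (envelope 1 a)%:E; first by exists 0%N.
    by rewrite lee_fin envelope_ge0.
  by case: S => [s s0 sj|_|//]; [exists s|rewrite ltNge leey].
have [V Va HV] := j_lsc cj.
have [e /= e0 He] : nbhs_ball a V by rewrite nbhs_ballE.
have [n hn] : exists n : nat, 2 * c / e ^+ 2 < n.+1%:R.
  exists (Num.truncn (2 * c / e ^+ 2)); exact: truncnS_gt.
have hle : envelope n.+1%:R a <= c.
  by rewrite -lee_fin (le_trans _ hc)//; apply: ereal_sup_ubound; exists n.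
have [hP|hP] := ltP `|a - prox n.+1%:R a| e.
  have := HV _ (He _ hP); rewrite -(fineK (prox_fin (nS0 n) a)) lte_fin.
  apply/negP; rewrite -leNgt (le_trans _ hle)// /envelope lerDl.
  by rewrite mulr_ge0 ?sqr_ge0.
have : c < envelope n.+1%:R a; last by rewrite ltNge hle.
rewrite /envelope ltr_wpDl ?fine_ge0//.
rewrite ltr_pdivrMr ?exprn_gt0// in hn.
have : e ^+ 2 <= (a - prox n.+1%:R a) ^+ 2.
  by rewrite -[leRHS]real_normK ?num_real// lerXn2r ?nnegrE// ltW.
set y := (a - prox n.+1%:R a) ^+ 2; set x := e ^+ 2 in hn * => xy.
have : n.+1%:R * x <= n.+1%:R * y by rewrite ler_pM2l.
by move: (n.+1%:R : R) x y hn {xy} => i x y; lra.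
Qed.

End moreau_yosida.

(** * Truncation at a given height *)

Section truncation.
Context {R : realType}.
Implicit Types K s t : R.

Definition clip K t : R := if t < - K then - K else if K < t then K else t.

Lemma clip_homo K s t : 0 <= K -> s <= t -> clip K s <= clip K t.
Proof.
move=> K0 st; rewrite /clip.
by case: (ltP s (- K)); case: (ltP K s); case: (ltP t (- K)); case: (ltP K t); lra.
Qed.

Lemma clip_lipschitz K s t : 0 <= K -> `|clip K s - clip K t| <= `|s - t|.
Proof.
move=> K0; wlog st : s t / s <= t.
  move=> H; have [/H//|/ltW/H] := leP s t.
  by rewrite distrC => h; rewrite [leRHS]distrC.
rewrite distrC [leRHS]distrC !ger0_norm ?subr_ge0 ?clip_homo// /clip.
by case: (ltP s (- K)); case: (ltP K s); case: (ltP t (- K)); case: (ltP K t); lra.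
Qed.

Lemma clip_bound K t : 0 <= K -> `|clip K t| <= K.
Proof.
move=> K0; rewrite ler_norml /clip.
by case: (ltP t (- K)); case: (ltP K t); lra.
Qed.

Lemma clip0 K : 0 <= K -> clip K 0 = 0.
Proof. by move=> K0; rewrite /clip oppr_gt0 !ltNge K0. Qed.

Lemma clip_le K t : 0 <= K -> `|clip K t| <= `|t|.
Proof.
by move=> K0; have := clip_lipschitz t 0 K0; rewrite clip0// !subr0.
Qed.

Lemma clip_dist_le K t : 0 <= K -> `|t - clip K t| <= `|t|.
Proof.
move=> K0; rewrite /clip; case: ltP => k1; last case: ltP => k2.
- by rewrite ler0_norm ?[leRHS]ler0_norm; lra.
- by rewrite ger0_norm ?[leRHS]ger0_norm; lra.
- by rewrite subrr normr0.
Qed.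

Lemma clip_id K t : `|t| <= K -> clip K t = t.
Proof.
by rewrite ler_norml /clip => /andP[h1 h2]; rewrite !ltNge h1 h2.
Qed.

Lemma clip_cvg t : clip n%:R t @[n --> \oo] --> t.
Proof.
apply: cvg_near_cst; near=> n; apply: clip_id.
by near: n; exact: nbhs_infty_ger.
Unshelve. all: by end_near. Qed.

Lemma measurable_clip K : 0 <= K -> measurable_fun [set: R] (clip K).
Proof.
by move=> K0; apply: nondecreasing_measurable => // s t; exact: clip_homo.
Qed.

End truncation.

(** * The energies as edge integrals, and integration by parts for Delta_p *)

Section energies.
Context {d : measure_display} {T : measurableType d} {R : realType}.
Variables (nu : {measure set T -> \bar R}) (m : R.-pker T ~> T).
Hypothesis sfin : sigma_finite [set: T] nu.
Hypothesis rev : reversible m nu.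
Local Notation N := (edge_measure nu m).
Implicit Types u v w phi : T -> R.

Definition grad u (z : T * T) : R := u z.2 - u z.1.

Lemma measurable_grad u : measurable_fun [set: T] u ->
  measurable_fun [set: T * T] (grad u).
Proof.
move=> mu; apply: measurable_funB.
  exact: (measurableT_comp mu measurable_snd).
exact: (measurableT_comp mu measurable_fst).
Qed.

Lemma grad_swap u z : grad u (swap z) = - grad u z.
Proof. by rewrite /grad /= opprB. Qed.

Let energyE (E : R -> R) c u : measurable_fun [set: R] E ->
  (forall t, 0 <= E t) -> measurable_fun [set: T] u ->
  (c%:E * \int[nu]_x \int[m x]_y (E (u y - u x))%:E =
  c%:E * \int[N]_z (E (grad u z))%:E)%E.
Proof.
move=> mE E0 mu; rewrite (edge_integral nu m (f := fun z => (E (grad u z))%:E))//.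
  by move=> z; rewrite lee_fin.
apply/measurable_EFinP; exact: (measurableT_comp mE (measurable_grad mu)).
Qed.

Let energy_lty (E : R -> R) c u : measurable_fun [set: R] E ->
  (forall t, 0 <= E t) -> measurable_fun [set: T] u -> 0 < c ->
  (c%:E * \int[nu]_x \int[m x]_y (E (u y - u x))%:E < +oo)%E <->
  Lint N (fun z => E (grad u z)).
Proof.
move=> mE E0 mu c0; rewrite energyE//; split.
  move=> h; apply: Lint_ge0 => [|z|]; first 1 last.
  - exact: E0.
  - rewrite ltNge; apply/negP; rewrite leye_eq => /eqP e.
    by move: h; rewrite e gt0_muley ?lte_fin// ltxx.
  - exact: (measurableT_comp mE (measurable_grad mu)).
by move=> l; rewrite EFin_RI// -EFinM ltry.
Qed.

Lemma F1_lty u : measurable_fun [set: T] u ->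
  (F1 nu m u < +oo)%E <-> Lint N (fun z => `|grad u z|).
Proof.
have mE : measurable_fun [set: R] (fun t : R => `|t|) by exact: normr_measurable.
move=> mu; apply: (energy_lty mE) => //; by rewrite invr_gt0.
Qed.

Lemma F1_RI u : measurable_fun [set: T] u -> Lint N (fun z => `|grad u z|) ->
  F1 nu m u = (2^-1 * RI N (fun z => `|grad u z|))%:E.
Proof.
have mE : measurable_fun [set: R] (fun t : R => `|t|) by exact: normr_measurable.
by move=> mu l; rewrite /F1 (energyE _ mE)// EFin_RI.
Qed.

Lemma F1_ge0 u : (0 <= F1 nu m u)%E.
Proof. by rewrite mule_ge0// integral_ge0// => x _; rewrite integral_ge0. Qed.

(** Both marginals of the edge measure are [nu], the second one by reversibility. The resulting
    constant 2 cancels the 1/2 in F_1, which is why the slope bound on [g] is 1. *)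
Lemma Lint_grad_le phi : Lint nu phi -> Lint N (grad phi) /\
  RI N (fun z => `|grad phi z|) <= 2 * RI nu (fun x => `|phi x|).
Proof.
move=> lphi; have mphi := Lint_measurable lphi.
have l := Lint_norm lphi.
have l1 : Lint N (fun z => `|phi z.1|) by exact: (Lint_edge_fst m l).
have l2 : Lint N (fun z => `|phi z.2|) by exact: (Lint_edge_snd sfin rev l).
have le z : `|grad phi z| <= `|phi z.2| + `|phi z.1| by exact: ler_normB.
have lg : Lint N (grad phi).
  by apply: Lint_le (LintD l2 l1) le; exact: measurable_grad.
split => //; rewrite (le_trans (RI_le (Lint_norm lg) (LintD l2 l1) le))//.
rewrite RI_D// (RI_edge_fst m l)// (RI_edge_snd sfin rev l)//.
by rewrite mulrDl mul1r.
Qed.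

Section power.
Variable p : R.
Hypothesis p1 : 1 < p.
Let p0 : 0 < p. Proof. exact: lt_trans p1. Qed.

Let mpow : measurable_fun [set: R] (fun t => `|t| `^ p).
Proof.
exact: (measurableT_comp (measurable_powR p) (@normr_measurable R setT)).
Qed.

Lemma measurable_pgrad u : measurable_fun [set: T] u ->
  measurable_fun [set: T * T] (fun z => `|grad u z| `^ p).
Proof. by move=> mu; exact: (measurableT_comp mpow (measurable_grad mu)). Qed.

Lemma Fp_lty u : measurable_fun [set: T] u ->
  (Fp p nu m u < +oo)%E <-> Lint N (fun z => `|grad u z| `^ p).
Proof.
move=> mu; apply: (energy_lty (E := fun t => `|t| `^ p)) => //.
by rewrite invr_gt0 mulr_gt0.
Qed.

Lemma Fp_RI u : measurable_fun [set: T] u ->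
  Lint N (fun z => `|grad u z| `^ p) ->
  Fp p nu m u = ((2 * p)^-1 * RI N (fun z => `|grad u z| `^ p))%:E.
Proof.
by move=> mu l; rewrite /Fp (energyE (E := fun t => `|t| `^ p))// EFin_RI.
Qed.

Lemma Fp_ge0 u : (0 <= Fp p nu m u)%E.
Proof.
apply: mule_ge0; first by rewrite lee_fin invr_ge0 mulr_ge0// ltW.
by apply: integral_ge0 => x _; apply: integral_ge0 => y _; rewrite lee_fin powR_ge0.
Qed.

Lemma pgrad_lty u : measurable_fun [set: T] u ->
  (\int[nu]_x \int[m x]_y (`|u y - u x| `^ p)%:E < +oo)%E <->
  Lint N (fun z => `|grad u z| `^ p).
Proof.
move=> mu; rewrite -[X in (X < _)%E]mul1e.
exact: (energy_lty (E := fun t => `|t| `^ p)).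
Qed.

Lemma measurable_sgpow_grad u : measurable_fun [set: T] u ->
  measurable_fun [set: T * T] (fun z => sgpow p (grad u z)).
Proof.
by move=> mu; exact: (measurableT_comp (measurable_sgpow p1) (measurable_grad mu)).
Qed.

Lemma Lint_sgpow_grad u (h : T * T -> R) : measurable_fun [set: T] u ->
  Lint N (fun z => `|grad u z| `^ p) -> measurable_fun [set: T * T] h ->
  Lint N (fun z => `|h z| `^ p) -> Lint N (fun z => sgpow p (grad u z) * h z).
Proof.
move=> mu lu mh lh; apply: Lint_le (LintD lu lh) _ => [|z].
  by apply: measurable_funM => //; exact: measurable_sgpow_grad.
exact: sgpow_young.
Qed.

Lemma RI_sgpow_grad u phi : measurable_fun [set: T] u ->
  measurable_fun [set: T] phi -> Lint N (fun z => `|grad u z| `^ p) ->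
  Lint nu (fun x => `|phi x| `^ p) ->
  Lint nu (fun x => phi x * kint m (fun z => sgpow p (grad u z)) x) /\
  RI N (fun z => sgpow p (grad u z) * grad phi z) =
  - 2 * RI nu (fun x => phi x * kint m (fun z => sgpow p (grad u z)) x).
Proof.
move=> mu mphi lu lphi.
apply: (RI_edge_antisym sfin rev (G := fun z => sgpow p (grad u z))) => //.
- exact: measurable_sgpow_grad.
- by move=> z; rewrite grad_swap sgpowN.
- apply: (Lint_sgpow_grad (h := fun z => phi z.1)) => //.
    exact: (measurableT_comp mphi measurable_fst).
  exact: (Lint_edge_fst m lphi).
Qed.

Lemma Lint_pgrad u : measurable_fun [set: T] u ->
  Lint nu (fun x => `|u x| `^ p) -> Lint N (fun z => `|grad u z| `^ p).
Proof.
move=> mu lu.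
have l1 := Lint_edge_fst m lu; have l2 := Lint_edge_snd sfin rev lu.
apply: Lint_le (LintZ (2 `^ p) (LintD l2 l1)) _; first exact: measurable_pgrad.
move=> z; rewrite ger0_norm ?powR_ge0// (le_trans (powRD_le p1 _ _))//.
by rewrite normrN.
Qed.

Lemma Lint_pgradD u v : measurable_fun [set: T] u -> measurable_fun [set: T] v ->
  Lint N (fun z => `|grad u z| `^ p) -> Lint N (fun z => `|grad v z| `^ p) ->
  Lint N (fun z => `|grad (fun x => u x + v x) z| `^ p).
Proof.
move=> mu mv lu lv.
apply: Lint_le (LintZ (2 `^ p) (LintD lu lv)) _.
  by apply: measurable_pgrad; exact: measurable_funD.
move=> z; rewrite ger0_norm ?powR_ge0//.
have -> : grad (fun x => u x + v x) z = grad u z + grad v z by rewrite /grad; ring.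
exact: powRD_le.
Qed.

Lemma Lint_pgradN u : Lint N (fun z => `|grad u z| `^ p) ->
  Lint N (fun z => `|grad (fun x => - u x) z| `^ p).
Proof. by apply: Lint_eq => z; rewrite /grad -opprD normrN. Qed.

Hypothesis finp : (nu [set: T] < +oo)%E \/ 2 <= p.

Lemma Lint_cst (c : R) : (nu [set: T] < +oo)%E -> 0 <= c -> Lint nu (fun=> c).
Proof.
move=> nuy c0; apply: Lint_ge0 => //.
by rewrite integral_cst// lte_mul_pinfty// lee_fin.
Qed.

(** The alternative between finite measure and p >= 2 acts here: a constant is integrable in the
    first case, and |phi|^p <= K^(p-2) phi^2 in the second. *)
Lemma bounded_L2_Lp phi (K : R) : inL2 nu phi -> (forall x, `|phi x| <= K) ->
  Lint nu (fun x => `|phi x| `^ p).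
Proof.
move=> /inL2P[mphi l2] phiK.
have mpp : measurable_fun [set: T] (fun x => `|phi x| `^ p).
  exact: (measurableT_comp mpow mphi).
case: finp => [nuy|p2].
  apply: Lint_le (Lint_cst nuy (powR_ge0 K p)) _ => // x.
  rewrite ger0_norm ?powR_ge0//; apply: (ge0_ler_powR (ltW p0)); rewrite ?nnegrE//.
  exact: le_trans (normr_ge0 _) (phiK x).
apply: Lint_le (LintZ (K `^ (p - 2)) l2) _ => // x.
have pE : p = (p - 2) + 2%:R by rewrite subrK.
rewrite ger0_norm ?powR_ge0// {1}pE powRD; last by rewrite -pE gt_eqF.
rewrite powR_mulrn// real_normK ?num_real//.
rewrite ler_wpM2r ?sqr_ge0//; apply: ge0_ler_powR; rewrite ?nnegrE ?subr_ge0//.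
exact: le_trans (normr_ge0 _) (phiK x).
Qed.

(* Only truncations of [phi] are known to be in L^p, hence the limit. *)
Lemma Deltap_by_parts u w phi : Deltap p nu m u w -> inL2 nu phi ->
  Lint N (fun z => `|grad phi z| `^ p) ->
  RI N (fun z => sgpow p (grad u z) * grad phi z) =
  - 2 * RI nu (fun x => phi x * w x).
Proof.
move=> [Lu Lw /(pgrad_lty (inL2_measurable Lu)) lu wE] Lphi lphi.
have mu := inL2_measurable Lu; have mw := inL2_measurable Lw.
have mphi := inL2_measurable Lphi.
pose phin (n : nat) x := clip n%:R (phi x).
have n0 (n : nat) : 0 <= n%:R :> R by [].
have mphin n : measurable_fun [set: T] (phin n).
  exact: (measurableT_comp (measurable_clip (n0 n)) mphi).
have Lphin n : inL2 nu (phin n).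
  by apply: inL2_norm_le Lphi _ => // x; exact: clip_le.
have IBP n : RI N (fun z => sgpow p (grad u z) * grad (phin n) z) =
    - 2 * RI nu (fun x => phin n x * w x).
  have lphin : Lint nu (fun x => `|phin n x| `^ p).
    by apply: bounded_L2_Lp (Lphin n) _ => x; exact: clip_bound.
  rewrite (RI_sgpow_grad mu (mphin n) lu lphin).2; congr (_ * _).
  apply: RI_ae_eq.
  - apply: measurable_funM => //; apply: measurable_kint.
    exact: measurable_sgpow_grad.
  - exact: measurable_funM.
  - by apply: filterS wE => x ->.
have [] := @RI_cvg _ _ _ N (fun n z => sgpow p (grad u z) * grad (phin n) z)
  (fun z => sgpow p (grad u z) * grad phi z)
  (fun z => `|grad u z| `^ p + `|grad phi z| `^ p).
- move=> n; apply: measurable_funM; first exact: measurable_sgpow_grad.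
  exact: measurable_grad.
- apply: measurable_funM; first exact: measurable_sgpow_grad.
  exact: measurable_grad.
- exact: LintD.
(* [clip] is 1-Lipschitz, so truncation shrinks the gradient and one dominating function serves all
   [n]. *)
- move=> n z; rewrite (le_trans (sgpow_young p1 _ _))// lerD2l.
  apply: (ge0_ler_powR (ltW p0)); rewrite ?nnegrE//.
  by rewrite /grad /phin clip_lipschitz.
- move=> z; apply: cvgM; first exact: cvg_cst.
  by apply: cvgB; exact: clip_cvg.
move=> _ c1.
have [] := @RI_cvg _ _ _ nu (fun n x => phin n x * w x) (fun x => phi x * w x)
  (fun x => `|phi x * w x|).
- by move=> n; exact: measurable_funM.
- exact: measurable_funM.
- exact/Lint_norm/inL2_Lint_mul.
- by move=> n x; rewrite !normrM ler_wpM2r// clip_le.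
- by move=> x; apply: cvgM; [exact: clip_cvg|exact: cvg_cst].
move=> _ c2.
rewrite (funext IBP) in c1; apply: (cvg_unique _ c1) => //.
by apply: cvgM => //; exact: cvg_cst.
Qed.

End power.

End energies.

(** * Comparison of two measures through a density bounded above and below *)

Section density.
Context {d : measure_display} {T : measurableType d} {R : realType}.
Variables (nu1 nu2 : {measure set T -> \bar R}) (mu : T -> R) (c M : R).
Hypothesis mmu : measurable_fun [set: T] mu.
Hypothesis nu2E :
  forall A, measurable A -> nu2 A = (\int[nu1]_(x in A) (mu x)%:E)%E.
Hypothesis muM : {ae nu1, forall x, `|mu x| <= M}.
Hypothesis c0 : 0 < c.
Hypothesis cmu : {ae nu1, forall x, c <= mu x}.

Let mnorm : measurable_fun [set: T] (fun x => `|mu x|).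
Proof. exact: (measurableT_comp (@normr_measurable R setT) mmu). Qed.

(** Presents [nu2] as a mixture over [nu1]. The weight is the absolute value because [mu] is known
    to be positive only almost everywhere. *)
Let weighted_dirac (x : T) : {measure set T -> \bar R} :=
  mscale (NngNum (normr_ge0 (mu x))) (dirac x).

Let weighted_diracE x A : weighted_dirac x A = (`|mu x| * \1_A x)%:E.
Proof. by rewrite EFinM. Qed.

Let nu2_mixture A : measurable A ->
  nu2 A = (\int[nu1]_x weighted_dirac x A)%E.
Proof.
move=> mA; rewrite nu2E// integral_mkcond; apply: ae_eq_integral => //.
- apply/(measurable_restrictT _ mA)/measurable_EFinP.
  exact: measurable_funS mmu.
- under eq_fun do rewrite weighted_diracE.
  by apply/measurable_EFinP/measurable_funM.
- apply: filterS cmu => x cx _; rewrite weighted_diracE /patch indicE.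
  rewrite ger0_norm; last exact: le_trans (ltW c0) cx.
  by case: (x \in A); rewrite ?mulr1 ?mulr0.
Qed.

Lemma density_integral (f : T -> \bar R) : (forall x, 0 <= f x)%E ->
  measurable_fun [set: T] f ->
  (\int[nu2]_x f x = \int[nu1]_x (`|mu x|%:E * f x))%E.
Proof.
move=> f0 mf; rewrite (integral_mixture (k := weighted_dirac) _ nu2_mixture)//.
  apply: eq_integral => x _.
  by rewrite ge0_integral_mscale// integral_dirac// diracT mul1e.
move=> A mA; under eq_fun do rewrite weighted_diracE.
by apply/measurable_EFinP/measurable_funM.
Qed.

(** The bound [c > 0] makes the measures mutually absolutely continuous: if [nu2 A = 0], then [mu]
    vanishes almost everywhere on [A], which contradicts [c <= mu] unless [A] is null. *)
Lemma density_null A : measurable A -> nu1 A = 0 <-> nu2 A = 0.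
Proof.
move=> mA; split => h.
  rewrite nu2E//; apply: null_set_integral => //.
  exact/measurable_EFinP/measurable_funTS.
have mg : measurable_fun [set: T] (fun x => (`|mu x| * \1_A x)%:E).
  by apply/measurable_EFinP/measurable_funM.
have : (\int[nu1]_x `|(`|mu x| * \1_A x)%:E| = 0)%E.
  rewrite -h nu2_mixture//; apply: eq_integral => x _.
  by rewrite weighted_diracE gee0_abs// lee_fin mulr_ge0.
move=> /(ae_eq_integral_abs nu1 measurableT mg) h0.
apply/negligibleP => //.
suff : {ae nu1, forall x, ~ A x}.
  by move=> [B [mB B0 AB]]; exists B; split => // x Ax; apply: AB => /=; exact.
apply: filterS2 h0 cmu => x /(_ I) /= + cx Ax; case=> /eqP.
rewrite indicE mem_set// mulr1 normr_eq0 => /eqP mx.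
by move: c0; rewrite ltNge (le_trans cx)// mx.
Qed.

Lemma density_ae (P : T -> Prop) :
  {ae nu1, forall x, P x} <-> {ae nu2, forall x, P x}.
Proof.
split=> -[A [mA A0 PA]]; exists A; split => //; exact/(density_null mA).
Qed.

Lemma Lint_density f : measurable_fun [set: T] f ->
  Lint nu2 f <-> Lint nu1 (fun x => mu x * f x).
Proof.
move=> mf.
have E : (\int[nu2]_x (`|f x|)%:E = \int[nu1]_x (`|mu x * f x|)%:E)%E.
  rewrite density_integral//; last by apply/measurable_EFinP/measurableT_comp.
  by apply: eq_integral => x _; rewrite -EFinM normrM.
split=> /integrableP[_ h]; apply/integrableP; split.
- by apply/measurable_EFinP/measurable_funM.
- by rewrite /= -E.
- exact/measurable_EFinP.
- by rewrite /= E.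
Qed.

Let RI_density_ge0 f : Lint nu2 f -> (forall x, 0 <= f x) ->
  RI nu2 f = RI nu1 (fun x => mu x * f x).
Proof.
move=> lf f0; have mf := Lint_measurable lf.
rewrite /RI /Rintegral density_integral//; last exact/measurable_EFinP.
congr fine; apply: ae_eq_integral => //.
- by apply: emeasurable_funM; exact/measurable_EFinP.
- by apply/measurable_EFinP/measurable_funM.
- apply: filterS cmu => x cx _; rewrite EFinM ger0_norm//.
  exact: le_trans (ltW c0) cx.
Qed.

Lemma RI_density f : Lint nu2 f -> RI nu2 f = RI nu1 (fun x => mu x * f x).
Proof.
move=> lf; have mf := Lint_measurable lf.
have lQ := Lint_norm lf; have lP := LintD lQ lf.
have L1 g : Lint nu2 g -> Lint nu1 (fun x => mu x * g x).
  by move=> lg; apply/(Lint_density (Lint_measurable lg)).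
have -> : RI nu2 f = RI nu2 (fun x => `|f x| + f x) - RI nu2 (fun x => `|f x|).
  by rewrite -RI_B//; congr RI; apply/funext => x; ring.
rewrite (RI_density_ge0 lP); last first.
  by move=> x; have := ler_norm (- f x); rewrite normrN; lra.
rewrite (RI_density_ge0 lQ); last by move=> x; exact: normr_ge0.
rewrite -RI_B; [|exact: L1..].
by congr RI; apply/funext => x; ring.
Qed.

Lemma inL2_density f : inL2 nu1 f <-> inL2 nu2 f.
Proof.
split=> /inL2P[mf lf]; apply/inL2P; split => //.
  have mf2 : measurable_fun [set: T] (fun x => f x ^+ 2) by exact: measurable_funX.
  apply/(Lint_density mf2); apply: Lint_ae_le (LintZ M lf) _.
    exact: measurable_funM.
  apply: filterS muM => x h.
  by rewrite normrM [X in _ * X]ger0_norm ?sqr_ge0// ler_wpM2r ?sqr_ge0.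
have mf2 : measurable_fun [set: T] (fun x => f x ^+ 2) by exact: measurable_funX.
apply: Lint_ae_le (LintZ c^-1 ((Lint_density mf2).1 lf)) _ => //.
apply: filterS cmu => x cx; rewrite ger0_norm ?sqr_ge0//.
by rewrite ler_pdivlMl// ler_wpM2r ?sqr_ge0.
Qed.

Lemma inL2_density_mul f : inL2 nu1 f -> inL2 nu1 (fun x => mu x * f x).
Proof.
move=> /inL2P[mf lf]; apply: (inL2_ae_le _ (LintZ (M ^+ 2) lf)).
  exact: measurable_funM.
apply: filterS muM => x h; rewrite exprMn ler_wpM2r ?sqr_ge0//.
rewrite -[leLHS]real_normK ?num_real// lerXn2r ?nnegrE//.
exact: le_trans (normr_ge0 _) h.
Qed.

Lemma Lint_density_bounded f : Lint nu1 f -> Lint nu2 f.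
Proof.
move=> lf; have mf := Lint_measurable lf; apply/(Lint_density mf).
apply: Lint_ae_le (LintZ M (Lint_norm lf)) _; first exact: measurable_funM.
by apply: filterS muM => x h; rewrite normrM ler_wpM2r.
Qed.

Lemma density_finite : (nu1 [set: T] < +oo)%E -> (nu2 [set: T] < +oo)%E.
Proof.
move=> fin1; have l1 : Lint nu1 (fun=> 1).
  by apply: Lint_ge0 => //; rewrite integral_cst// mul1e.
by have := Lint_lty (Lint_density_bounded l1); rewrite normr1 integral_cst// mul1e.
Qed.

End density.

(** The shift [s] lies between 0 and a - b, so a - s and b + s stay between a and b with the same
    sum; convexity of the absolute value concludes. *)
Lemma norm_exchange (R : realDomainType) (a b s : R) :
  (0 <= s /\ s <= a - b) \/ (s <= 0 /\ a - b <= s) ->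
  `|a - s| + `|b + s| <= `|a| + `|b|.
Proof.
have := ler_norm a; have := ler_norm b.
have := ler_norm (- a); have := ler_norm (- b); rewrite !normrN.
by case: (ger0P (a - s)); case: (ger0P (b + s)); lra.
Qed.

Lemma measurable_sgr (R : realType) : measurable_fun [set: R] (@Num.sg R).
Proof.
apply: nondecreasing_measurable => // a b ab.
by case: (sgrP a); case: (sgrP b) => //; lra.
Qed.

(** * Monotonicity, subgradients and explicit elements for each energy *)

Section operators.
Context {d : measure_display} {T : measurableType d} {R : realType}.
Variables (nu : {measure set T -> \bar R}) (m : R.-pker T ~> T).
Hypothesis sfin : sigma_finite [set: T] nu.
Hypothesis rev : reversible m nu.
Local Notation N := (edge_measure nu m).
Implicit Types u v w f phi : T -> R.

Lemma F1_add_le u phi : measurable_fun [set: T] u -> Lint nu phi ->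
  (F1 nu m (fun x => u x + phi x)%R
    <= F1 nu m u + (RI nu (fun x => `|phi x|))%:E)%E.
Proof.
move=> mu lphi; have mphi := Lint_measurable lphi.
have [/(F1_lty nu m mu) lu|] := boolP (F1 nu m u < +oo)%E; last first.
  by rewrite -leNgt leye_eq => /eqP ->; rewrite addye// leey.
have [lg hle] := Lint_grad_le sfin rev lphi.
have le z : `|grad (fun x => u x + phi x) z| <= `|grad u z| + `|grad phi z|.
  rewrite (_ : grad _ z = grad u z + grad phi z); first exact: ler_normD.
  by rewrite /grad; ring.
have lsum := LintD lu (Lint_norm lg).
have mup : measurable_fun [set: T] (fun x => u x + phi x) by exact: measurable_funD.
have l : Lint N (fun z => `|grad (fun x => u x + phi x) z|).
  apply: Lint_le lsum _ => [|z]; last by rewrite normr_id.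
  by apply: measurableT_comp => //; exact: measurable_grad.
rewrite (F1_RI mup l) (F1_RI mu lu) -EFinD lee_fin.
have := RI_le l lsum le; rewrite RI_D//; last exact: Lint_norm.
lra.
Qed.

Section lipschitz_test.
Variables (q : R -> R) (k : R).
Hypothesis k0 : 0 < k.
Hypothesis q_homo : forall a b, a <= b -> q a <= q b.
Hypothesis q_lip : forall a b, `|q b - q a| <= k * `|b - a|.
Hypothesis q0 : q 0 = 0.

Let mq : measurable_fun [set: R] q.
Proof. by apply: nondecreasing_measurable => // a b; exact: q_homo. Qed.

Lemma inL2_lipschitz f : inL2 nu f -> inL2 nu (fun x => q (f x)).
Proof.
move=> Lf; apply: (inL2_norm_le _ (inL2Z k Lf)) => [|x].
  exact: (measurableT_comp mq (inL2_measurable Lf)).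
by have := q_lip 0 (f x); rewrite q0 !subr0 normrM (gtr0_norm k0).
Qed.

(** The subgradient inequalities are tested at u1 - psi and u2 + psi with psi = q(u1 - u2)/k. On
    each edge [norm_exchange] applies, so the total energy of the pair does not increase. *)
Lemma subdiff_F1_monotone u1 v1 u2 v2 :
  subdiff nu (F1 nu m) u1 v1 -> subdiff nu (F1 nu m) u2 v2 ->
  0 <= RI nu (fun x => q (u1 x - u2 x) * (v1 x - v2 x)).
Proof.
move=> [Lu1 Lv1 Fu1 H1] [Lu2 Lv2 Fu2 H2].
have mu1 := inL2_measurable Lu1; have mu2 := inL2_measurable Lu2.
have LQ : inL2 nu (fun x => q (u1 x - u2 x)).
  by apply: (inL2_lipschitz (f := fun x => u1 x - u2 x)); exact: inL2B.
(* Dividing by [k] makes psi a nondecreasing 1-Lipschitz function of u1 - u2, so its increment on an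
   edge lies between 0 and that of u1 - u2. *)
pose psi x := k^-1 * q (u1 x - u2 x).
have Lpsi : inL2 nu psi by exact: inL2Z.
pose f1 x := u1 x - psi x; pose f2 x := u2 x + psi x.
have Lf1 : inL2 nu f1 by exact: inL2B.
have Lf2 : inL2 nu f2 by exact: inL2D.
have lu1 := (F1_lty nu m mu1).1 Fu1; have lu2 := (F1_lty nu m mu2).1 Fu2.
have le z : `|grad f1 z| + `|grad f2 z| <= `|grad u1 z| + `|grad u2 z|.
  have -> : grad f1 z = grad u1 z - grad psi z by rewrite /grad /f1; ring.
  have -> : grad f2 z = grad u2 z + grad psi z by rewrite /grad /f2; ring.
  have Egrad : grad u1 z - grad u2 z = (u1 z.2 - u2 z.2) - (u1 z.1 - u2 z.1).
    by rewrite /grad; ring.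
  have : `|grad psi z| <= `|grad u1 z - grad u2 z|.
    rewrite /grad /psi -mulrBr normrM gtr0_norm ?invr_gt0// ler_pdivrMl//.
    by rewrite -/(grad u1 z) -/(grad u2 z) Egrad; exact: q_lip.
  have : 0 <= grad psi z * (grad u1 z - grad u2 z).
    rewrite Egrad /grad /psi -mulrBr -mulrA.
    apply: mulr_ge0; first by rewrite invr_ge0 ltW.
    case: (leP (u1 z.1 - u2 z.1) (u1 z.2 - u2 z.2)) => [h|/ltW h].
      by rewrite mulr_ge0 ?subr_ge0// q_homo.
    by rewrite mulr_le0// subr_le0// q_homo.
  move: (grad u1 z) (grad u2 z) (grad psi z) => a b s h1 h2.
  have : (0 <= s /\ s <= a - b) \/ (s <= 0 /\ a - b <= s).
    have [ab|ab|ab] := ltgtP 0 (a - b).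
    - left; rewrite pmulr_lge0// in h1; rewrite h1; split => //.
      by rewrite (gtr0_norm ab) ger0_norm// in h2.
    - right; rewrite nmulr_lge0// in h1; rewrite h1; split => //.
      by rewrite (ltr0_norm ab) ler0_norm// lerN2 in h2.
    - left; rewrite -ab normr0 normr_le0 in h2; move/eqP: h2 => ->.
      by rewrite ab lexx.
  exact: norm_exchange.
have mf1 := inL2_measurable Lf1; have mf2 := inL2_measurable Lf2.
have lsum := LintD lu1 lu2.
have lf1 : Lint N (fun z => `|grad f1 z|).
  apply: Lint_le lsum _ => [|z].
    by apply: measurableT_comp => //; exact: measurable_grad.
  by rewrite normr_id (le_trans _ (le z))// lerDl.
have lf2 : Lint N (fun z => `|grad f2 z|).
  apply: Lint_le lsum _ => [|z].
    by apply: measurableT_comp => //; exact: measurable_grad.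
  by rewrite normr_id (le_trans _ (le z))// lerDr.
have := RI_le (LintD lf1 lf2) lsum le; rewrite !RI_D// => hsum.
have l1 := inL2_Lint_mul Lv1 Lpsi; have l2 := inL2_Lint_mul Lv2 Lpsi.
have := H1 _ Lf1; rewrite (F1_RI mu1 lu1) (F1_RI mf1 lf1).
rewrite (_ : (fun x => (v1 x * (f1 x - u1 x))%:E) =
    (fun x => (- (v1 x * psi x))%:E)); last first.
  by apply/funext => x; congr EFin; rewrite /f1; ring.
rewrite EFin_RI; last exact: LintN.
rewrite RI_N// -EFinD lee_fin => h1.
have := H2 _ Lf2; rewrite (F1_RI mu2 lu2) (F1_RI mf2 lf2).
rewrite (_ : (fun x => (v2 x * (f2 x - u2 x))%:E) =
    (fun x => (v2 x * psi x)%:E)); last first.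
  by apply/funext => x; congr EFin; rewrite /f2; ring.
rewrite EFin_RI// -EFinD lee_fin => h2.
rewrite (_ : (fun x => _) = (fun x => k * (v1 x * psi x - v2 x * psi x))); last first.
  by apply/funext => x; rewrite /psi; field; rewrite gt_eqF.
rewrite RI_Z; last exact: LintB.
rewrite RI_B//; apply: mulr_ge0; first exact: ltW.
by move: hsum h1 h2; move: (RI N _) (RI N _) (RI N _) (RI N _) (RI nu _) (RI nu _) => *; lra.
Qed.

Section power.
Variable p : R.
Hypothesis p1 : 1 < p.
Hypothesis finp : (nu [set: T] < +oo)%E \/ 2 <= p.
Let p0 : 0 < p. Proof. exact: lt_trans p1. Qed.

(** On an edge the increment of q(u1 - u2) and the difference of the two signed powers never have
    opposite signs; integration by parts reverses the sign. The Lipschitz bound keeps the gradient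
    of the test function in L^p. *)
Lemma Deltap_monotone u1 w1 u2 w2 : Deltap p nu m u1 w1 -> Deltap p nu m u2 w2 ->
  RI nu (fun x => q (u1 x - u2 x) * (w1 x - w2 x)) <= 0.
Proof.
move=> D1 D2; have [Lu1 Lw1 E1 _] := D1; have [Lu2 Lw2 E2 _] := D2.
have mu1 := inL2_measurable Lu1; have mu2 := inL2_measurable Lu2.
have l1 := (pgrad_lty nu m p mu1).1 E1; have l2 := (pgrad_lty nu m p mu2).1 E2.
pose phi x := q (u1 x - u2 x).
have Lphi : inL2 nu phi.
  by apply: (inL2_lipschitz (f := fun x => u1 x - u2 x)); exact: inL2B.
have mphi := inL2_measurable Lphi.
have Egrad z : grad u1 z - grad u2 z = (u1 z.2 - u2 z.2) - (u1 z.1 - u2 z.1).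
  by rewrite /grad; ring.
have lphi : Lint N (fun z => `|grad phi z| `^ p).
  have l := Lint_pgradD p1 mu1 (measurable_funN mu2) l1 (Lint_pgradN l2).
  apply: Lint_le (LintZ (k `^ p) l) _ => [|z]; first exact: measurable_pgrad.
  have kge0 := ltW k0; rewrite ger0_norm ?powR_ge0// -powRM//.
  apply: (ge0_ler_powR (ltW p0)); rewrite ?nnegrE ?mulr_ge0//.
  rewrite /grad /phi (_ : _ - (_ + _) = (u1 z.2 - u2 z.2) - (u1 z.1 - u2 z.1)).
    exact: q_lip.
  by [].
have I1 := Deltap_by_parts sfin rev p1 finp D1 Lphi lphi.
have I2 := Deltap_by_parts sfin rev p1 finp D2 Lphi lphi.
have mgphi := measurable_grad mphi.
have s1 := Lint_sgpow_grad p1 mu1 l1 mgphi lphi.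
have s2 := Lint_sgpow_grad p1 mu2 l2 mgphi lphi.
have : 0 <= RI N (fun z => sgpow p (grad u1 z) * grad phi z
                         - sgpow p (grad u2 z) * grad phi z).
  apply: RI_ge0 => z; rewrite -mulrBl.
  case: (leP (grad u2 z) (grad u1 z)) => [h|/ltW h].
    rewrite mulr_ge0 ?subr_ge0 ?sgpow_homo//; apply: q_homo.
    by rewrite -subr_ge0 -Egrad subr_ge0.
  rewrite mulr_le0// subr_le0 ?sgpow_homo//; apply: q_homo.
  by rewrite -subr_le0 -Egrad subr_le0.
rewrite RI_B// I1 I2.
rewrite (_ : (fun x => q _ * _) = (fun x => phi x * w1 x - phi x * w2 x)); last first.
  by apply/funext => x; rewrite /phi mulrBr.
rewrite RI_B; [|exact: inL2_Lint_mul..].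
by move: (RI nu _) (RI nu _) => A B {I1 I2}; lra.
Qed.

End power.

End lipschitz_test.

Section power.
Variable p : R.
Hypothesis p1 : 1 < p.
Let p0 : 0 < p. Proof. exact: lt_trans p1. Qed.

Lemma Fp_subgradient u w f : (nu [set: T] < +oo)%E \/ 2 <= p ->
  Deltap p nu m u w -> inL2 nu f ->
  (Fp p nu m u <= Fp p nu m f + (RI nu (fun x => (f x - u x) * w x))%:E)%E.
Proof.
move=> finp D Lf; have [Lu Lw E _] := D.
have mu := inL2_measurable Lu; have mf := inL2_measurable Lf.
have lu := (pgrad_lty nu m p mu).1 E.
have [/(Fp_lty nu m p1 mf) lf|] := boolP (Fp p nu m f < +oo)%E; last first.
  by rewrite -leNgt leye_eq => /eqP ->; rewrite addye// leey.
have Lphi := inL2B Lf Lu.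
have lphi : Lint N (fun z => `|grad (fun x => f x - u x) z| `^ p).
  exact: (Lint_pgradD p1 mf (measurable_funN mu) lf (Lint_pgradN lu)).
have mphi := inL2_measurable Lphi.
have s := Lint_sgpow_grad p1 mu lu (measurable_grad mphi) lphi.
rewrite (Fp_RI mu lu) (Fp_RI mf lf) -EFinD lee_fin.
have := Deltap_by_parts sfin rev p1 finp D Lphi lphi.
have : RI N (fun z => `|grad u z| `^ p
    + p * (sgpow p (grad u z) * grad (fun x => f x - u x) z))
    <= RI N (fun z => `|grad f z| `^ p).
  apply: RI_le => //; first by apply: LintD => //; exact: LintZ.
  move=> z; rewrite (_ : grad (fun x => f x - u x) z = grad f z - grad u z).
    exact: powR_tangent.
  by rewrite /grad; ring.
rewrite RI_D//; last exact: LintZ.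
rewrite RI_Z// => + E2; rewrite E2 => h.
move: h; set A := RI N (fun z => `|grad u z| `^ p).
set B := RI N (fun z => `|grad f z| `^ p); move: A B (RI nu _) => A B C h.
(* The p of the tangent inequality and the 2 of the integration by parts cancel against 1/(2p). *)
have -> : (2 * p)^-1 * B + C = (2 * p)^-1 * (B + 2 * p * C).
  by field; rewrite gt_eqF.
by rewrite ler_pM2l ?invr_gt0 ?mulr_gt0//; lra.
Qed.

End power.

(** Each [m x] is a probability, so [kint m G] is bounded by [C]; a bounded integrable function is
    square integrable. *)
Lemma inL2_kint (G : T * T -> R) (C : R) : measurable_fun [set: T * T] G ->
  (forall z, `|G z| <= C) -> Lint N G -> inL2 nu (kint m G).
Proof.
move=> mG GC lG; have lk := Lint_kint lG; have mk := Lint_measurable lk.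
apply: (inL2_le (h := fun x => C * `|kint m G x|)) => // [|x].
  exact/LintZ/Lint_norm.
have C0 : 0 <= C by exact: le_trans (normr_ge0 _) (GC (x, x)).
rewrite -real_normK ?num_real// expr2 ler_wpM2r//.
rewrite -lee_fin (le_trans (kint_norm_le m x mG))//.
have -> : C%:E = (\int[m x]_y C%:E)%E by rewrite integral_cst// prob_kernel mule1.
apply: ge0_le_integral => //.
- by apply/measurable_EFinP/measurableT_comp => //; exact: measurable_fun_pair2.
- by move=> y _; rewrite lee_fin.
Qed.

Section bounded_support.
Variables (u : T -> R) (K : R).
Hypothesis mu : measurable_fun [set: T] u.
Hypothesis uK : forall x, `|u x| <= K.
(* [sg (u x) ^+ 2] is the indicator function of the support of [u]. *)
Hypothesis usupp : Lint nu (fun x => Num.sg (u x) ^+ 2).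

Lemma inL2_bounded_support : inL2 nu u.
Proof.
apply: (inL2_le _ (LintZ (K ^+ 2) usupp)) => // x.
have [->|u0] := eqVneq (u x) 0; first by rewrite sgr0 expr0n mulr0.
rewrite sqr_sg u0 mulr1 -real_normK ?num_real// lerXn2r ?nnegrE//.
exact: le_trans (uK x).
Qed.

(** An edge with nonzero gradient has an endpoint in the support of [u], and both marginals are
    [nu]: the bounded [G] lives on a set of finite measure. *)
Lemma Lint_bounded_support (G : T * T -> R) (C : R) :
  measurable_fun [set: T * T] G -> (forall z, `|G z| <= C) ->
  (forall z, grad u z = 0 -> G z = 0) -> Lint N G.
Proof.
move=> mG GC G0.
have l1 := Lint_edge_fst m usupp; have l2 := Lint_edge_snd sfin rev usupp.
apply: Lint_le (LintZ C (LintD l1 l2)) _ => // z.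
have C0 : 0 <= C by exact: le_trans (GC z).
have [g0|g0] := eqVneq (grad u z) 0.
  by rewrite G0// normr0 mulr_ge0// addr_ge0// sqr_ge0.
rewrite (le_trans (GC z))// ler_peMr// !sqr_sg -natrD ler1n.
have [e1|e1] := eqVneq (u z.1) 0; have [e2|e2] := eqVneq (u z.2) 0 => //=.
by move: g0; rewrite /grad e1 e2 subrr eqxx.
Qed.

Let msg : measurable_fun [set: T * T] (fun z => Num.sg (grad u z)).
Proof.
exact: (measurableT_comp (@measurable_sgr R) (measurable_grad mu)).
Qed.

Let sg1 z : `|Num.sg (grad u z)| <= 1.
Proof. by rewrite normr_sg; case: (_ != 0). Qed.

Let lsg : Lint N (fun z => Num.sg (grad u z)).
Proof.
by apply: (Lint_bounded_support (C := 1)) => // z ->; rewrite sgr0.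
Qed.

(** The sign of the gradient, 0 where the gradient vanishes, is an antisymmetric selection of the
    subdifferential of the absolute value on edges; integration by parts turns it into a subgradient
    of F_1. *)
Lemma subdiff_F1_sign :
  subdiff nu (F1 nu m) u (fun x => - kint m (fun z => Num.sg (grad u z)) x).
Proof.
have Lu := inL2_bounded_support.
have Lk : inL2 nu (kint m (fun z => Num.sg (grad u z))) by exact: inL2_kint lsg.
have lu : Lint N (fun z => `|grad u z|).
  apply: (Lint_bounded_support (C := K + K)) => [|z|z ->].
  - by apply: measurableT_comp => //; exact: measurable_grad.
  - by rewrite normr_id (le_trans (ler_normB _ _))// lerD.
  - by rewrite normr0.
split => //; first exact: inL2N.
  by apply/(F1_lty nu m mu).
move=> f Lf; have mf := inL2_measurable Lf.
have [/(F1_lty nu m mf) lf|] := boolP (F1 nu m f < +oo)%E; last first.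
  by rewrite -leNgt leye_eq => /eqP ->; rewrite leey.
have Lphi := inL2B Lf Lu; have mphi := inL2_measurable Lphi.
(* Bounded and integrable, the sign lies in L^2 of the edges and pairs with [f - u], which need not
   be integrable. *)
have LG : inL2 N (fun z => Num.sg (grad u z)).
  apply: (inL2_le _ (Lint_norm lsg)) => // z.
  by rewrite -real_normK ?num_real// expr2 ler_piMr.
have Lphi1 : inL2 N (fun z => f z.1 - u z.1).
  apply/inL2P; split; first exact: (measurableT_comp mphi measurable_fst).
  exact: (Lint_edge_fst m (inL2_Lint_sqr Lphi)).
have [] := RI_edge_antisym sfin rev msg _ (inL2_Lint_mul LG Lphi1) mphi.
  by move=> z; rewrite grad_swap sgrN.
set k := kint m _ => lk kE.
rewrite (F1_RI mu lu) (F1_RI mf lf).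
rewrite (_ : (fun x => (- k x * (f x - u x))%:E) =
    (fun x => (- ((f x - u x) * k x))%:E)); last first.
  by apply/funext => x; congr EFin; ring.
rewrite EFin_RI; last exact: LintN.
rewrite RI_N// -EFinD lee_fin.
have lG : Lint N (fun z => Num.sg (grad u z) * grad (fun x => f x - u x) z).
  apply: Lint_le (LintD lf lu) _ => [|z].
    by apply: measurable_funM => //; exact: measurable_grad.
  rewrite normrM (@le_trans _ _ `|grad (fun x => f x - u x) z|) ?ler_piMl//.
  rewrite (_ : grad (fun x => f x - u x) z = grad f z - grad u z).
    exact: ler_normB.
  by rewrite /grad; ring.
have : RI N (fun z => `|grad u z| + Num.sg (grad u z) * grad (fun x => f x - u x) z)
    <= RI N (fun z => `|grad f z|).
  apply: RI_le => //; first exact: LintD.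
  move=> z; rewrite (_ : grad (fun x => f x - u x) z = grad f z - grad u z).
    rewrite mulrBr -normrEsg addrC subrK (le_trans (ler_norm _))//.
    by rewrite normrM ler_piMl.
  by rewrite /grad; ring.
rewrite RI_D// kE; move: (RI N _) (RI N _) (RI nu _) => A B D {kE}; lra.
Qed.

Lemma Deltap_bounded_support p : 1 < p ->
  Deltap p nu m u (kint m (fun z => sgpow p (grad u z))).
Proof.
move=> p1; have Lu := inL2_bounded_support.
have p0 : 0 < p by exact: lt_trans p1.
have pB0 : 0 < p - 1 by rewrite subr_gt0.
have gK z : `|grad u z| <= K + K by rewrite (le_trans (ler_normB _ _))// lerD.
have K0 (z : T * T) : 0 <= K + K by exact: le_trans (normr_ge0 _) (gK z).
have mG := measurable_sgpow_grad p1 mu.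
have GC z : `|sgpow p (grad u z)| <= (K + K) `^ (p - 1).
  by rewrite (normr_sgpow p1) (ge0_ler_powR (ltW pB0)) ?nnegrE// (K0 z).
have lG : Lint N (fun z => sgpow p (grad u z)).
  apply: Lint_bounded_support GC _ => // z ->.
  by rewrite /sgpow sgr0 mul0r.
split => //.
- exact: inL2_kint GC lG.
- apply/(pgrad_lty nu m p mu).
  apply: (Lint_bounded_support (C := (K + K) `^ p)) => [|z|z ->].
  + exact: measurable_pgrad.
  + rewrite ger0_norm ?powR_ge0// (ge0_ler_powR (ltW p0)) ?nnegrE//.
    exact: K0 z.
  + by rewrite normr0 powR0// gt_eqF.
- exact: aeW.
Qed.

End bounded_support.

End operators.

(** Division of the difference quotient by t: A, At, B stand for 2 F_1 at u, u + t phi, u + phi; P,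
    Pt for 2p F_p at u, u + t phi; S for the p-pairing at u + t phi; V for (v, phi). *)
Lemma directional_arith (R : realFieldType) (p t A At B P Pt S V : R) :
  0 < p -> 0 < t -> At <= (1 - t) * A + t * B -> Pt + - (p * t) * S <= P ->
  2^-1 * A + (2 * p)^-1 * P + t * V <= 2^-1 * At + (2 * p)^-1 * Pt ->
  2^-1 * A + V <= 2^-1 * B + 2^-1 * S.
Proof.
move=> p0 t0 h1 h2 h.
have h3 : (2 * p)^-1 * Pt <= (2 * p)^-1 * P + t * S / 2.
  have -> : t * S / 2 = (2 * p)^-1 * (p * t * S) by field; rewrite gt_eqF.
  by rewrite -mulrDr ler_pM2l ?invr_gt0 ?mulr_gt0//; lra.
rewrite -(ler_pM2l t0); move: h h3.
by move: (_ * Pt) (_ * P) => x y; lra.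
Qed.

Lemma sqr_le_sum (R : realDomainType) (a b s : R) :
  0 <= a -> a <= b + s -> a ^+ 2 <= 2 * b ^+ 2 + 2 * s ^+ 2.
Proof.
move=> a0 h; have := sqr_ge0 (b - s).
have : a ^+ 2 <= (b + s) ^+ 2 by rewrite lerXn2r// nnegrE// (le_trans a0).
rewrite !expr2; lra.
Qed.

(** * Equality of the subdifferential and the operator *)

Section main.
Context {d : measure_display} {T : measurableType d} {R : realType}.
Variables (p : R) (m1 m2 : R.-pker T ~> T) (nu1 nu2 : {measure set T -> \bar R}).
Variables (mu : T -> R) (c M : R).
Hypothesis p1 : 1 < p.
Hypothesis sfin1 : sigma_finite [set: T] nu1.
Hypothesis rev1 : reversible m1 nu1.
Hypothesis sfin2 : sigma_finite [set: T] nu2.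
Hypothesis rev2 : reversible m2 nu2.
Hypothesis mmu : measurable_fun [set: T] mu.
Hypothesis nu2E :
  forall A, measurable A -> nu2 A = (\int[nu1]_(x in A) (mu x)%:E)%E.
Hypothesis muM : {ae nu1, forall x, `|mu x| <= M}.
Hypothesis c0 : 0 < c.
Hypothesis cmu : {ae nu1, forall x, c <= mu x}.
Hypothesis fin1 : (nu1 [set: T] < +oo)%E \/ 2 <= p.
Local Notation N1 := (edge_measure nu1 m1).
Local Notation N2 := (edge_measure nu2 m2).
Local Notation F := (fun w => F1 nu1 m1 w + Fp p nu2 m2 w)%E.
Implicit Types u v w f phi : T -> R.

Let p0 : 0 < p. Proof. exact: lt_trans p1. Qed.

Let fin2 : (nu2 [set: T] < +oo)%E \/ 2 <= p.
Proof. by case: fin1 => h; [left; exact: (density_finite mmu nu2E muM c0 cmu)|right]. Qed.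

Let L12 f : inL2 nu1 f <-> inL2 nu2 f.
Proof. exact: (inL2_density mmu nu2E muM c0 cmu). Qed.

(** The sign changes in [opA] and in [Delta1] cancel, leaving a genuine subgradient [g] of F_1. *)
Lemma opA_decomposition u v : opA p nu1 m1 nu2 m2 mu u v ->
  exists g w, [/\ subdiff nu1 (F1 nu1 m1) u g, Deltap p nu2 m2 u w,
    inL2 nu1 (fun x => mu x * w x) & {ae nu1, forall x, v x = g x - mu x * w x}].
Proof.
move=> [Lu Lv [g [v2 [w [D1 Dp v2E vE]]]]]; exists g, w; split => //.
- move: D1; rewrite /Delta1; congr subdiff.
  by apply/funext => x; rewrite opprK.
- apply: (inL2_density_mul mmu muM); apply/L12; by case: Dp.
- by apply: filterS2 v2E vE => x -> ->.
Qed.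

Lemma opA_subdiff u v : opA p nu1 m1 nu2 m2 mu u v -> subdiff nu1 F u v.
Proof.
move=> A; have [Lu Lv _] := A.
have [g [w [D1 Dp Lmw vE]]] := opA_decomposition A.
have [_ Lg Fu H] := D1; have [Lu2 Lw2 E _] := Dp.
have mu_ := inL2_measurable Lu.
have Fpu : (Fp p nu2 m2 u < +oo)%E.
  exact/(Fp_lty nu2 m2 p1 mu_)/(pgrad_lty nu2 m2 p mu_).
split => //; first exact: lte_add_pinfty.
move=> f Lf; have Lphi := inL2B Lf Lu.
have h1 := H _ Lf; have h2 := Fp_subgradient sfin2 rev2 p1 fin2 Dp ((L12 f).1 Lf).
have lg := inL2_Lint_mul Lg Lphi; have lw := inL2_Lint_mul Lphi Lmw.
have lw2 := inL2_Lint_mul ((L12 _).1 Lphi) Lw2.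
rewrite EFin_RI// in h1.
rewrite (RI_density mmu nu2E c0 cmu lw2) in h2.
have lv := inL2_Lint_mul Lv Lphi.
have vphiE : RI nu1 (fun x => v x * (f x - u x)) =
    RI nu1 (fun x => g x * (f x - u x)) - RI nu1 (fun x => mu x * ((f x - u x) * w x)).
  rewrite (_ : (fun x => mu x * _) = (fun x => (f x - u x) * (mu x * w x))).
    rewrite -RI_B//; apply: RI_ae_eq.
    - exact: Lint_measurable lv.
    - exact: Lint_measurable (LintB lg lw).
    - by apply: filterS vE => x ->; ring.
  by apply/funext => x; ring.
rewrite EFin_RI// vphiE.
move: (RI nu1 _) (RI nu1 _) h1 h2 => a b.
have := F1_ge0 nu1 m1 f; have := Fp_ge0 nu2 m2 p1 f.
have := F1_ge0 nu1 m1 u; have := Fp_ge0 nu2 m2 p1 u; move: Fu Fpu.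
case: (F1 nu1 m1 u) => [r| |] //; case: (Fp p nu2 m2 u) => [s| |] // _ _ _ _.
case: (F1 nu1 m1 f) => [r'| |] //; case: (Fp p nu2 m2 f) => [s'| |] // _ _;
  rewrite ?addye ?addey ?leey//.
by rewrite -!EFinD !lee_fin; lra.
Qed.

Section subdiff_to_opA.
Variables (u v : T -> R).
Hypothesis uv : subdiff nu1 F u v.

Let Lu : inL2 nu1 u. Proof. by case: uv. Qed.
Let Lv : inL2 nu1 v. Proof. by case: uv. Qed.
Let mu_ : measurable_fun [set: T] u. Proof. exact: inL2_measurable Lu. Qed.
Let mv : measurable_fun [set: T] v. Proof. exact: inL2_measurable Lv. Qed.

Let lu1 : Lint N1 (fun z => `|grad u z|).
Proof.
case: uv => _ _ h _; apply/(F1_lty nu1 m1 mu_); apply: le_lt_trans h.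
by rewrite leeDl// Fp_ge0.
Qed.

Let lup : Lint N2 (fun z => `|grad u z| `^ p).
Proof.
case: uv => _ _ h _; apply/(Fp_lty nu2 m2 p1 mu_); apply: le_lt_trans h.
by rewrite leeDr// F1_ge0.
Qed.

(* The limit, as t tends to 0, of the subgradient inequality at [u + t phi];
   F1 is only convex, so its increment is bounded by the one at t = 1. *)
Lemma subdiff_directional phi : inL2 nu1 phi ->
  Lint N2 (fun z => `|grad phi z| `^ p) ->
  (F1 nu1 m1 u + (RI nu1 (fun x => v x * phi x))%:E
   <= F1 nu1 m1 (fun x => u x + phi x)%R
      + (2^-1 * RI N2 (fun z => sgpow p (grad u z) * grad phi z))%:E)%E.
Proof.
move=> Lphi lphi; have mphi := inL2_measurable Lphi.
have mup : measurable_fun [set: T] (fun x => u x + phi x) by exact: measurable_funD.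
have [|] := boolP (F1 nu1 m1 (fun x => u x + phi x)%R < +oo)%E; last first.
  by rewrite -leNgt leye_eq => /eqP ->; rewrite addye// leey.
move=> /(F1_lty nu1 m1 mup) lup1.
rewrite (F1_RI mu_ lu1) (F1_RI mup lup1) -!EFinD lee_fin.
pose t (n : nat) : R := n.+1%:R^-1.
have t0 n : 0 < t n by rewrite invr_gt0.
have t1 n : t n <= 1 by rewrite invf_le1// ler1n.
have lvphi := inL2_Lint_mul Lv Lphi.
have key n : 2^-1 * RI N1 (fun z => `|grad u z|) + RI nu1 (fun x => v x * phi x) <=
    2^-1 * RI N1 (fun z => `|grad (fun x => u x + phi x) z|) + 2^-1 *
    RI N2 (fun z => sgpow p (grad u z + t n * grad phi z) * grad phi z).
  pose ut x := u x + t n * phi x.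
  have Ltphi : inL2 nu1 (fun x => t n * phi x) by exact: inL2Z.
  have Lut : inL2 nu1 ut by exact: inL2D.
  have mut := inL2_measurable Lut.
  have gut z : grad ut z = grad u z + t n * grad phi z by rewrite /grad /ut; ring.
  have le1 z : `|grad ut z| <=
      (1 - t n) * `|grad u z| + t n * `|grad (fun x => u x + phi x) z|.
    have -> : grad ut z = (1 - t n) * grad u z + t n * grad (fun x => u x + phi x) z.
      by rewrite /grad /ut; ring.
    rewrite (le_trans (ler_normD _ _))// !normrM (gtr0_norm (t0 n)).
    by rewrite (@ger0_norm _ (1 - t n)) ?subr_ge0.
  have lc := LintD (LintZ (1 - t n) lu1) (LintZ (t n) lup1).
  have lut1 : Lint N1 (fun z => `|grad ut z|).
    apply: Lint_le lc _ => [|z]; last by rewrite normr_id.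
    by apply: measurableT_comp => //; exact: measurable_grad.
  have h1 := RI_le lut1 lc le1.
  rewrite RI_D ?RI_Z// in h1; [|exact: LintZ..].
  have ltp : Lint N2 (fun z => `|grad (fun x => t n * phi x) z| `^ p).
    apply: Lint_le lphi _ => [|z]; first exact: (measurable_pgrad p (inL2_measurable Ltphi)).
    rewrite ger0_norm ?powR_ge0//; apply: (ge0_ler_powR (ltW p0)); rewrite ?nnegrE//.
    by rewrite /grad -mulrBr normrM (gtr0_norm (t0 n)) ler_piMl.
  have lutp : Lint N2 (fun z => `|grad ut z| `^ p) :=
    Lint_pgradD p1 mu_ (inL2_measurable Ltphi) lup ltp.
  have s := Lint_sgpow_grad p1 mut lutp (measurable_grad mphi) lphi.
  have sE : RI N2 (fun z => sgpow p (grad u z + t n * grad phi z) * grad phi z) =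
      RI N2 (fun z => sgpow p (grad ut z) * grad phi z).
    by congr RI; apply/funext => z; rewrite gut.
  have h2 : RI N2 (fun z => `|grad ut z| `^ p) +
      - (p * t n) * RI N2 (fun z => sgpow p (grad ut z) * grad phi z)
      <= RI N2 (fun z => `|grad u z| `^ p).
    have ls := LintZ (- (p * t n)) s.
    rewrite -(RI_Z _ s) -(RI_D lutp ls); apply: (RI_le (LintD lutp ls) lup) => z.
    (* The tangent is taken at [ut], which bounds F_p(ut) - F_p(u) from above by the pairing at
       [ut]; a limit in [t n] then remains. *)
    have := powR_tangent p1 (grad ut z) (grad u z).
    rewrite (_ : grad u z - grad ut z = - (t n * grad phi z)); last by rewrite gut; ring.
    by apply: le_trans; rewrite le_eqVlt; apply/orP; left; apply/eqP; ring.
  have [_ _ _ /(_ _ Lut)] := uv.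
  rewrite (F1_RI mu_ lu1) (Fp_RI mu_ lup) (F1_RI mut lut1) (Fp_RI mut lutp).
  rewrite (_ : (fun x => (v x * (ut x - u x))%:E) =
      (fun x => (t n * (v x * phi x))%:E)); last first.
    by apply/funext => x; congr EFin; rewrite /ut; ring.
  rewrite (EFin_RI (LintZ (t n) lvphi)) (RI_Z _ lvphi) -!EFinD lee_fin sE.
  exact: (directional_arith p0 (t0 n) h1 h2).
(* Since [t n <= 1], the integrands have a bound independent of [n]. *)
have [] := @RI_cvg _ _ _ N2
  (fun n z => sgpow p (grad u z + t n * grad phi z) * grad phi z)
  (fun z => sgpow p (grad u z) * grad phi z)
  (fun z => 2 `^ p * (`|grad u z| `^ p + `|grad phi z| `^ p) + `|grad phi z| `^ p).
- move=> n; apply: measurable_funM; last exact: measurable_grad.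
  apply: (measurableT_comp (measurable_sgpow p1)).
  apply: measurable_funD; first exact: measurable_grad.
  by apply: measurable_funM => //; exact: measurable_grad.
- apply: measurable_funM; last exact: measurable_grad.
  exact: measurable_sgpow_grad.
- by apply: LintD => //; apply: LintZ; exact: LintD.
- move=> n z; rewrite (le_trans (sgpow_young p1 _ _))// lerD2r.
  rewrite (le_trans (powRD_le p1 _ _))// ler_pM2l ?powR_gt0// lerD2l.
  apply: (ge0_ler_powR (ltW p0)); rewrite ?nnegrE//.
  by rewrite normrM (gtr0_norm (t0 n)) ler_piMl.
- move=> z; apply: cvgM; last exact: cvg_cst.
  have : grad u z + t n * grad phi z @[n --> \oo] --> grad u z + 0 * grad phi z.
    apply: cvgD; first exact: cvg_cst.
    by apply: cvgM; [exact: cvg_harmonic|exact: cvg_cst].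
  rewrite mul0r addr0 => ct.
  exact: (cvg_comp _ _ ct (@sgpow_continuous _ p p1 (grad u z))).
move=> _ cvS.
set B := 2^-1 * RI N1 (fun z => `|grad (fun x => u x + phi x) z|) in key *.
have : B + 2^-1 * RI N2 (fun z => sgpow p (grad u z + t n * grad phi z) * grad phi z)
    @[n --> \oo] --> B + 2^-1 * RI N2 (fun z => sgpow p (grad u z) * grad phi z).
  apply: cvgD; first exact: cvg_cst.
  by apply: cvgM => //; exact: cvg_cst.
move=> cv; rewrite -(cvg_lim _ cv)//; apply: limr_ge.
  by apply/cvg_ex; eexists; exact: cv.
by apply: nearW => n; exact: key.
Qed.

(** Candidate for Delta_p u. Nothing yet places it in L^2, so it is paired only with test functions
    that lie in L^2 and in L^p. *)
Let W := kint m2 (fun z => sgpow p (grad u z)).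
Let g x := v x + mu x * W x.

Let mW : measurable_fun [set: T] W.
Proof. by apply: measurable_kint; exact: measurable_sgpow_grad. Qed.

Let mg : measurable_fun [set: T] g.
Proof. by apply: measurable_funD => //; exact: measurable_funM. Qed.

Let test_Lp phi : inL2 nu1 phi -> Lint nu2 (fun x => `|phi x| `^ p) ->
  Lint nu1 (fun x => g x * phi x) /\
  (F1 nu1 m1 u + (RI nu1 (fun x => g x * phi x))%:E
   <= F1 nu1 m1 (fun x => u x + phi x)%R)%E.
Proof.
move=> Lphi lphi; have mphi := inL2_measurable Lphi.
have [lW WE] := RI_sgpow_grad sfin2 rev2 p1 mu_ mphi lup lphi.
have mphiW := Lint_measurable lW.
have lmW := (Lint_density mmu nu2E c0 cmu mphiW).1 lW.
have lv := inL2_Lint_mul Lv Lphi.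
have gE : (fun x => g x * phi x) = (fun x => v x * phi x + mu x * (phi x * W x)).
  by apply/funext => x; rewrite /g; ring.
rewrite gE; split; first exact: LintD.
have := subdiff_directional Lphi (Lint_pgrad sfin2 rev2 p1 mphi lphi).
rewrite WE (RI_density mmu nu2E c0 cmu lW) RI_D// (F1_RI mu_ lu1) -!EFinD.
have := F1_ge0 nu1 m1 (fun x => u x + phi x).
case: (F1 nu1 m1 (fun x => u x + phi x)) => [r| |] //; rewrite ?leey//.
rewrite -EFinD !lee_fin => _.
by move: (RI N1 _) (RI nu1 _) (RI nu1 _) => A B C; lra.
Qed.

Let test_L1 phi : inL2 nu1 phi -> Lint nu2 (fun x => `|phi x| `^ p) ->
  Lint nu1 phi -> RI nu1 (fun x => g x * phi x) <= RI nu1 (fun x => `|phi x|).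
Proof.
move=> Lphi lphi l1; have [_ h] := test_Lp Lphi lphi.
have := le_trans h (F1_add_le sfin1 rev1 mu_ l1).
by rewrite (F1_RI mu_ lu1) -!EFinD lee_fin lerD2l.
Qed.

(** Detects the set where |g| > 1: [t * theta t - |theta t|] is nonnegative and vanishes only for
    |t| <= 1. *)
Let theta (t : R) : R := if t < - 1 then - 1 else if 1 < t then 1 else 0.

Let theta_homo s t : s <= t -> theta s <= theta t.
Proof.
move=> st; rewrite /theta.
by case: (ltP s (- 1)); case: (ltP 1 s); case: (ltP t (- 1)); case: (ltP 1 t); lra.
Qed.

Let mtheta : measurable_fun [set: R] theta.
Proof. by apply: nondecreasing_measurable => // s t; exact: theta_homo. Qed.

Let theta_norm t : `|theta t| <= 1.
Proof.
rewrite /theta; case: ltP => _; first by rewrite normrN normr1.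
by case: ltP => _; rewrite ?normr1 ?normr0.
Qed.

Let theta_ge t : `|theta t| <= t * theta t.
Proof.
rewrite /theta; case: ltP => h1; first by rewrite normrN normr1; lra.
by case: ltP => h2; rewrite ?normr1 ?normr0; lra.
Qed.

Let theta_eq t : t * theta t = `|theta t| -> `|t| <= 1.
Proof.
rewrite ler_norml /theta; case: ltP => h1; first by rewrite normrN normr1; lra.
by case: ltP => h2; rewrite ?normr1 ?normr0; lra.
Qed.

(** On a piece [E k] of finite measure, [theta (g x)] cut off outside [E k] is an admissible test
    function. By [test_L1] the nonnegative g phi - |phi| has integral at most 0, so it vanishes
    almost everywhere. *)
Let g_le1 : {ae nu1, forall x, `|g x| <= 1}.
Proof.
have [E ET Efin] := sfin1.
suff : {ae nu1, forall x, forall k, E k x -> `|g x| <= 1}.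
  apply: filterS => x h; have : [set: T] x by [].
  by rewrite ET => -[k _ /h].
apply/ae_foralln => k; have [mE Ey] := Efin k.
pose phi x := \1_(E k) x * theta (g x).
have l1 : Lint nu1 (\1_(E k) : T -> R).
  by apply: Lint_ge0 => //; rewrite integral_indic// setIT.
have l2 : Lint nu2 (\1_(E k) : T -> R).
  exact: (Lint_density_bounded mmu nu2E muM c0 cmu l1).
have mphi : measurable_fun [set: T] phi.
  by apply: measurable_funM => //; exact: (measurableT_comp mtheta mg).
have phiE x : `|phi x| <= \1_(E k) x.
  by rewrite normrM ger0_norm// ler_piMr.
have lphi : Lint nu1 phi by exact: Lint_le l1 phiE.
have Lphi : inL2 nu1 phi.
  apply: inL2_le l1 _ => // x; rewrite -real_normK ?num_real//.
  have phi1 : `|phi x| <= 1.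
    by rewrite (le_trans (phiE x))// indicE; case: (_ \in _).
  by rewrite expr2 (le_trans _ (phiE x))// ler_piMl.
have lphip : Lint nu2 (fun x => `|phi x| `^ p).
  apply: Lint_le l2 _ => [|x].
    apply: (measurableT_comp (measurable_powR p)).
    exact: measurableT_comp.
  rewrite ger0_norm ?powR_ge0//; have := phiE x; rewrite indicE.
  case: (_ \in _) => /= h.
    rewrite (@le_trans _ _ (1 `^ p))//; last by rewrite powR1.
    by apply: (ge0_ler_powR (ltW p0)); rewrite ?nnegrE.
  have -> : `|phi x| = 0 by apply/eqP; rewrite eq_le h normr_ge0.
  by rewrite powR0// gt_eqF.
have [lgphi _] := test_Lp Lphi lphip.
have := test_L1 Lphi lphip lphi => hle.
pose h x := g x * phi x - `|phi x|.
have lh : Lint nu1 h by apply: LintB => //; exact: Lint_norm.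
have h0 x : 0 <= h x.
  rewrite /h /phi normrM (@ger0_norm _ (\1_(E k) x))// mulrCA -mulrBr.
  by rewrite mulr_ge0// subr_ge0.
have : (\int[nu1]_x `|(h x)%:E| = 0)%E.
  under eq_integral do rewrite gee0_abs ?lee_fin//.
  rewrite EFin_RI//; congr EFin; apply/eqP; rewrite eq_le RI_ge0// andbT.
  by rewrite RI_B ?subr_le0//; exact: Lint_norm.
have mh : measurable_fun [set: T] (fun x => (h x)%:E).
  exact/measurable_EFinP/(Lint_measurable lh).
move=> /(ae_eq_integral_abs nu1 measurableT mh); apply: filterS => x /(_ I) [] hx Ex.
apply: theta_eq; apply/eqP; rewrite -subr_eq0; apply/eqP.
by move: hx; rewrite /h /phi indicE mem_set// !mul1r.
Qed.

Let Q := kint m2 (fun z => `|grad u z| `^ p).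

Let lQ1 : Lint nu1 Q.
Proof.
have lQ := Lint_kint lup; have mQ := Lint_measurable lQ.
apply: Lint_ae_le (LintZ c^-1 ((Lint_density mmu nu2E c0 cmu mQ).1 lQ)) _ => //.
have Q0 x : 0 <= Q x by apply: Rintegral_ge0 => y _; exact: powR_ge0.
apply: filterS cmu => x cx; rewrite ger0_norm//.
by rewrite ler_pdivlMl// ler_wpM2r.
Qed.

(** With al the minimum of 1 and |W|, [mul_powR_le] integrated against the probability [m2 x] gives
    al^2 <= al^2/2 + 2 Q. Absorbing the half yields the constant 4. The estimate holds [nu2]-a.e.
    and is carried to [nu1]. *)
Let minW_le : 2 <= p -> {ae nu1, forall x, Num.min 1 `|W x| ^+ 2 <= 4 * Q x}.
Proof.
move=> p2; apply/(density_ae mmu nu2E c0 cmu).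
apply: filterS (edge_ae_Lint lup) => x lx.
set al := Num.min 1 `|W x|.
have al0 : 0 <= al by rewrite le_min ler01 normr_ge0.
have al1 : al <= 1 by rewrite ge_min lexx.
have alW : al <= `|W x| by rewrite ge_min lexx orbT.
have mG := measurable_sgpow_grad p1 mu_.
have mGx : measurable_fun [set: T] (fun y => (`|sgpow p (grad u (x, y))|)%:E).
  by apply/measurable_EFinP/measurableT_comp => //; exact: measurable_fun_pair2 mG.
have l2 : Lint (m2 x) (fun y => al ^+ 2 / 2 + 2 * `|grad u (x, y)| `^ p).
  apply: LintD; last exact: LintZ.
  apply: Lint_cst; first by rewrite prob_kernel ltry.
  by rewrite divr_ge0// sqr_ge0.
suff : ((al ^+ 2)%:E <= (al ^+ 2 / 2 + 2 * Q x)%:E)%E by rewrite lee_fin; lra.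
apply: (@le_trans _ _ (al%:E * \int[m2 x]_y (`|sgpow p (grad u (x, y))|)%:E)%E).
  rewrite expr2 EFinM; apply: lee_wpmul2l; first by rewrite lee_fin.
  by apply: le_trans (kint_norm_le m2 x mG); rewrite lee_fin.
rewrite -ge0_integralZl//.
have -> : (al ^+ 2 / 2 + 2 * Q x)%:E =
    (\int[m2 x]_y (al ^+ 2 / 2 + 2 * `|grad u (x, y)| `^ p)%:E)%E.
  rewrite EFin_RI// RI_D//; last exact: LintZ.
    by rewrite RI_Z// /RI Rintegral_cst// prob_kernel mulr1.
  apply: Lint_cst; first by rewrite prob_kernel ltry.
  by rewrite divr_ge0// sqr_ge0.
apply: ge0_le_integral => //.
- by move=> y _; rewrite mule_ge0.
- exact: measurable_funeM.
- exact/measurable_EFinP/(Lint_measurable l2).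
- move=> y _; rewrite -EFinM lee_fin normr_sgpow// mul_powR_le//.
  by rewrite al0.
Qed.

Let Lg : inL2 nu1 g.
Proof.
case: fin1 => [nuy|p2].
  apply: (inL2_ae_le mg (Lint_cst nuy ler01)).
  apply: filterS g_le1 => x h; rewrite -real_normK ?num_real//.
  by rewrite expr_le1.
(* [M' >= 1] lets one bound cover both regions below; the 8 is twice the constant 4 of [minW_le]. *)
pose M' := `|M| + 1.
apply: (inL2_ae_le mg (h := fun x => 2 * v x ^+ 2 + 8 * M' ^+ 2 * Q x)).
  by apply: LintD; apply: LintZ => //; exact: inL2_Lint_sqr.
apply: filterS3 g_le1 muM (minW_le p2) => x g1 mM.
set al := Num.min 1 _ => alQ.
have M'1 : 1 <= M' by rewrite /M' lerDr.
suff h : g x ^+ 2 <= 2 * v x ^+ 2 + 2 * M' ^+ 2 * al ^+ 2.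
  rewrite (le_trans h)// lerD2l; have : 0 <= 2 * M' ^+ 2 by rewrite mulr_ge0// sqr_ge0.
  move=> M2; rewrite (_ : 8 * M' ^+ 2 * Q x = 2 * M' ^+ 2 * (4 * Q x)); last by ring.
  by rewrite ler_wpM2l.
have g2 : g x ^+ 2 = `|g x| ^+ 2 by rewrite real_normK ?num_real.
(* Where |W| <= 1, al equals |W| and the definition of [g] is estimated term by term; elsewhere al =
   1 and |g| <= 1 suffices. *)
have [W1|W1] := leP `|W x| 1.
  have -> : al = `|W x| by exact/min_idPr.
  have : `|g x| <= `|v x| + M' * `|W x|.
    rewrite (le_trans (ler_normD _ _))// lerD2l normrM ler_wpM2r//.
    by rewrite (le_trans mM)// (le_trans (ler_norm _))// /M' lerDl.
  rewrite g2 -[v x ^+ 2]real_normK ?num_real//.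
  rewrite -mulrA -exprMn; exact: sqr_le_sum (normr_ge0 _).
have -> : al = 1 by apply/min_idPl; exact: ltW.
rewrite expr1n mulr1 (@le_trans _ _ 1)//.
  by rewrite g2 expr_le1.
have : 1 <= M' ^+ 2 by exact: exprn_ege1.
by have := sqr_ge0 (v x); move: (v x ^+ 2) (M' ^+ 2) => ? ?; lra.
Qed.

(** The product mu W = g - v is in L^2, and mu >= c > 0 allows division. *)
Let LW : inL2 nu1 W.
Proof.
have l := LintD (inL2_Lint_sqr Lg) (inL2_Lint_sqr Lv).
apply: (inL2_ae_le mW (LintZ (c^-1 ^+ 2 * 2) l)).
apply: filterS cmu => x cx.
have h : c * `|W x| <= `|g x| + `|v x|.
  rewrite (le_trans _ (ler_normB _ _))// /g addrAC subrr add0r normrM.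
  by rewrite ler_wpM2r// (le_trans cx)// ler_norm.
have := sqr_le_sum (mulr_ge0 (ltW c0) (normr_ge0 _)) h.
rewrite exprMn !real_normK ?num_real// => h2.
rewrite -mulrA exprVn ler_pdivlMl ?exprn_gt0//.
by rewrite (le_trans h2)// mulrDr.
Qed.

(* Truncations of [phi] are admissible test functions, and the L^1 distance
   from [phi] to its truncation at height n is at most |phi|^2 / n. *)
Let subdiff_F1_g : subdiff nu1 (F1 nu1 m1) u g.
Proof.
split => //; first by apply/(F1_lty nu1 m1 mu_).
move=> f Lf; have mf := inL2_measurable Lf.
have [/(F1_lty nu1 m1 mf) lf|] := boolP (F1 nu1 m1 f < +oo)%E; last first.
  by rewrite -leNgt leye_eq => /eqP ->; rewrite leey.
have Lphi := inL2B Lf Lu; set phi := (fun x => f x - u x) in Lphi.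
have lphi2 := inL2_Lint_sqr Lphi; have mphi := inL2_measurable Lphi.
have lgphi := inL2_Lint_mul Lg Lphi.
rewrite (EFin_RI lgphi) (F1_RI mu_ lu1) (F1_RI mf lf) -EFinD lee_fin.
set S := RI nu1 (fun x => phi x ^+ 2).
have S0 : 0 <= S by apply: RI_ge0 => x; exact: sqr_ge0.
(* One error S/(n+1) comes from replacing F_1(u + Tn) by F_1(f), the other from replacing phi by Tn
   in the pairing with [g], where |g| <= 1 is used again. *)
have key (n : nat) : 2^-1 * RI N1 (fun z => `|grad u z|) +
    RI nu1 (fun x => g x * phi x) <=
    2^-1 * RI N1 (fun z => `|grad f z|) + 2 * (n.+1%:R^-1 * S).
  have n0 : 0 < n.+1%:R :> R by [].
  pose Tn x := clip n.+1%:R (phi x).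
  have mTn : measurable_fun [set: T] Tn.
    exact: (measurableT_comp (measurable_clip (ltW n0)) mphi).
  have LTn : inL2 nu1 Tn.
    by apply: inL2_norm_le Lphi _ => // x; exact: clip_le (ltW n0).
  have lTn : Lint nu2 (fun x => `|Tn x| `^ p).
    apply: (bounded_L2_Lp p1 fin2 ((L12 _).1 LTn)) => x.
    exact: clip_bound (ltW n0).
  have [lgT h1] := test_Lp LTn lTn.
  pose psi x := Tn x - phi x.
  have Lpsi : inL2 nu1 psi by exact: inL2B.
  have lS := LintZ n.+1%:R^-1 lphi2.
  have psi_le x : `|psi x| <= n.+1%:R^-1 * phi x ^+ 2.
    rewrite /psi /Tn; have [h|h] := leP `|phi x| n.+1%:R.
      by rewrite clip_id// subrr normr0 mulr_ge0 ?sqr_ge0// invr_ge0.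
    rewrite ler_pdivlMl// -[phi x ^+ 2]real_normK ?num_real// expr2.
    have := clip_dist_le (phi x) (ltW n0); rewrite distrC.
    move=> h2; apply: ler_pM => //; exact: ltW.
  have lpsi : Lint nu1 psi by exact: Lint_le (inL2_measurable Lpsi) lS psi_le.
  have := F1_add_le sfin1 rev1 mf lpsi.
  rewrite (_ : (fun x => f x + psi x) = (fun x => u x + Tn x)); last first.
    by apply/funext => x; rewrite /psi /phi; ring.
  move=> /(le_trans h1); rewrite (F1_RI mu_ lu1) (F1_RI mf lf) -!EFinD lee_fin => h3.
  have h4 : RI nu1 (fun x => `|psi x|) <= n.+1%:R^-1 * S.
    by rewrite -RI_Z//; apply: RI_le => //; exact: Lint_norm.
  have h5 : RI nu1 (fun x => g x * phi x) <=
      RI nu1 (fun x => g x * Tn x) + n.+1%:R^-1 * S.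
    rewrite -RI_Z// -RI_D//; apply: RI_ae_le => //; first exact: LintD.
    apply: filterS g_le1 => x g1.
    have -> : g x * phi x = g x * Tn x + - (g x * psi x) by rewrite /psi; ring.
    rewrite lerD2l (le_trans (ler_norm _))// normrN normrM.
    by rewrite (le_trans _ (psi_le x))// ler_piMl.
  move: h3 h4 h5; move: (RI N1 _) (RI N1 _) (RI nu1 _) (RI nu1 _) (RI nu1 _) (_ * S).
  by move=> *; lra.
apply/ler_addgt0Pr => e e0.
have h := key (Num.truncn (2 * S / e)).
apply: (le_trans h); rewrite lerD2l.
have := truncnS_gt (2 * S / e); set n := (Num.truncn _).+1.
rewrite ltr_pdivrMr// => hn.
by rewrite mulrCA ler_pdivrMl//; exact: ltW.
Qed.

Lemma subdiff_opA : opA p nu1 m1 nu2 m2 mu u v.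
Proof.
split => //; exists g, (fun x => - (mu x * W x)), W; split.
- rewrite /Delta1 (_ : (fun x => - - g x) = g)//.
  by apply/funext => x; rewrite opprK.
- split; [exact/L12|exact/L12| |exact: aeW].
  exact/(pgrad_lty nu2 m2 p mu_).
- exact: aeW.
- by apply: aeW => x; rewrite /g; ring.
Qed.

End subdiff_to_opA.

End main.

(** * Complete accretivity and density of the domain *)

Section accretivity.
Context {d : measure_display} {T : measurableType d} {R : realType}.
Variables (p : R) (m1 m2 : R.-pker T ~> T) (nu1 nu2 : {measure set T -> \bar R}).
Variables (mu : T -> R) (c M : R).
Hypothesis p1 : 1 < p.
Hypothesis sfin1 : sigma_finite [set: T] nu1.
Hypothesis rev1 : reversible m1 nu1.
Hypothesis sfin2 : sigma_finite [set: T] nu2.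
Hypothesis rev2 : reversible m2 nu2.
Hypothesis mmu : measurable_fun [set: T] mu.
Hypothesis nu2E :
  forall A, measurable A -> nu2 A = (\int[nu1]_(x in A) (mu x)%:E)%E.
Hypothesis muM : {ae nu1, forall x, `|mu x| <= M}.
Hypothesis c0 : 0 < c.
Hypothesis cmu : {ae nu1, forall x, c <= mu x}.

(** The F_1 part is nonnegative against [nu1], the Delta_p part nonpositive against [nu2]; the
    density [mu] brings both to [nu1], where the latter enters with a minus sign. *)
Lemma opA_monotone (q : R -> R) (k : R) u1 v1 u2 v2 :
  (nu1 [set: T] < +oo)%E \/ 2 <= p -> 0 < k ->
  (forall a b, a <= b -> q a <= q b) ->
  (forall a b, `|q b - q a| <= k * `|b - a|) -> q 0 = 0 ->
  opA p nu1 m1 nu2 m2 mu u1 v1 -> opA p nu1 m1 nu2 m2 mu u2 v2 ->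
  0 <= RI nu1 (fun x => q (u1 x - u2 x) * (v1 x - v2 x)).
Proof.
move=> fin1 k0 q_homo q_lip q0 A1 A2.
have fin2 : (nu2 [set: T] < +oo)%E \/ 2 <= p.
  by case: fin1 => h; [left; exact: (density_finite mmu nu2E muM c0 cmu)|right].
have [Lu1 Lv1 _] := A1; have [Lu2 Lv2 _] := A2.
have [g1 [w1 [D1 P1 Lw1 E1]]] := opA_decomposition mmu nu2E muM c0 cmu A1.
have [g2 [w2 [D2 P2 Lw2 E2]]] := opA_decomposition mmu nu2E muM c0 cmu A2.
have [_ Lg1 _ _] := D1; have [_ Lg2 _ _] := D2.
have [U1 Lww1 _ _] := P1; have [U2 Lww2 _ _] := P2.
have h1 := subdiff_F1_monotone k0 q_homo q_lip q0 D1 D2.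
have h2 := Deltap_monotone sfin2 rev2 k0 q_homo q_lip q0 p1 fin2 P1 P2.
have LQ := inL2_lipschitz k0 q_homo q_lip q0 (inL2B Lu1 Lu2).
have LQ2 := inL2_lipschitz k0 q_homo q_lip q0 (inL2B U1 U2).
have l2 := inL2_Lint_mul LQ2 (inL2B Lww1 Lww2).
rewrite (RI_density mmu nu2E c0 cmu l2) in h2.
have lg := inL2_Lint_mul LQ (inL2B Lg1 Lg2).
have lw := (Lint_density mmu nu2E c0 cmu (Lint_measurable l2)).1 l2.
have lv := inL2_Lint_mul LQ (inL2B Lv1 Lv2).
rewrite (RI_ae_eq (g := fun x => q (u1 x - u2 x) * (g1 x - g2 x)
    - mu x * (q (u1 x - u2 x) * (w1 x - w2 x)))).
- rewrite (RI_B lg lw); move: (RI nu1 _) (RI nu1 _) h1 h2 => a b; lra.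
- exact: Lint_measurable lv.
- exact: Lint_measurable (LintB lg lw).
- by apply: filterS2 E1 E2 => x -> ->; ring.
Qed.

Lemma opA_completely_accretive : (nu1 [set: T] < +oo)%E \/ 2 <= p ->
  completely_accretive nu1 (opA p nu1 m1 nu2 m2 mu).
Proof.
move=> fin1 lam lam0 u1 v1 u2 v2 A1 A2 j jc jl j0 j00.
have [Lu1 Lv1 _] := A1; have [Lu2 Lv2 _] := A2.
pose u x := u1 x - u2 x; pose w x := u1 x - u2 x + lam * (v1 x - v2 x).
have Lu : inL2 nu1 u by exact: inL2B.
have Lv : inL2 nu1 (fun x => v1 x - v2 x) by exact: inL2B.
have Lw : inL2 nu1 w by apply: inL2D => //; exact: inL2Z.
have mu_ := inL2_measurable Lu; have mw := inL2_measurable Lw.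
have mj := lower_semicontinuous_measurable jl.
have nS0 (n : nat) : 0 < n.+1%:R :> R by [].
(* Regularizations of [j] with parameter n + 1, at most quadratic and therefore integrable along L^2
   functions. *)
pose e (n : nat) := envelope jl j0 j00 n.+1%:R.
have Le n f : inL2 nu1 f -> Lint nu1 (fun x => e n (f x)).
  move=> Lf; apply: Lint_le (LintZ (n.+1%:R / 2) (inL2_Lint_sqr Lf)) _.
    exact: (measurableT_comp (measurable_envelope jc jl j0 j00 (nS0 n)) (inL2_measurable Lf)).
  by move=> x; rewrite ger0_norm ?envelope_ge0// envelope_le_sqr.
have step n : (\int[nu1]_x (e n (u x))%:E <= \int[nu1]_x j (w x))%E.
  apply: (@le_trans _ _ (\int[nu1]_x (e n (w x))%:E)%E); last first.
    apply: ge0_le_integral => //.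
    - by move=> x _; rewrite lee_fin envelope_ge0.
    - exact/measurable_EFinP/(Lint_measurable (Le n _ Lw)).
    - exact: measurableT_comp.
    - by move=> x _; exact: envelope_le.
  have lu := Le n _ Lu; have lw := Le n _ Lw.
  rewrite (EFin_RI lu) (EFin_RI lw) lee_fin.
  pose q := yosida jl j0 j00 n.+1%:R.
  have q_homo a b : a <= b -> q a <= q b by exact: yosida_homo.
  have q_lip a b : `|q b - q a| <= n.+1%:R * `|b - a| by exact: yosida_lipschitz.
  have q0 : q 0 = 0 by exact: yosida0.
  have h := opA_monotone fin1 (nS0 n) q_homo q_lip q0 A1 A2.
  have lq : Lint nu1 (fun x => q (u x) * (v1 x - v2 x)).
    by apply: inL2_Lint_mul => //; exact: (inL2_lipschitz (nS0 n) q_homo q_lip q0 Lu).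
  apply: (@le_trans _ _ (RI nu1 (fun x => e n (u x) + lam * (q (u x) * (v1 x - v2 x))))).
    by rewrite (RI_D lu (LintZ lam lq)) (RI_Z lam lq) lerDl mulr_ge0// ltW.
  apply: (RI_le (LintD lu (LintZ lam lq)) lw) => x.
  rewrite (le_trans _ (envelope_subgradient jc jl j0 j00 (nS0 n) (u x) (w x)))//.
  rewrite lerD2l /w /u addrAC subrr add0r.
  by rewrite le_eqVlt; apply/orP; left; apply/eqP; rewrite /q; ring.
(* Only the left side needs a limit: on the right the envelope is already bounded by [j]. *)
rewrite (_ : (\int[nu1]_x j (u1 x - u2 x)%R)%E =
    (limn (fun n => \int[nu1]_x (e n (u x))%:E))%E); last first.
  rewrite -monotone_convergence//.
  - by apply: eq_integral => x _; apply/esym/cvg_lim => //; exact: envelope_cvg.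
  - by move=> n; exact/measurable_EFinP/(Lint_measurable (Le n _ Lu)).
  - by move=> n x _; rewrite lee_fin envelope_ge0.
  - move=> x _ a b ab; rewrite lee_fin; apply: envelope_le_param => //.
    by rewrite ler_nat ltnS.
apply: lime_le; last by apply: nearW => n; exact: step.
apply: ereal_nondecreasing_is_cvgn => a b ab; apply: ge0_le_integral => //.
- by move=> x _; rewrite lee_fin envelope_ge0.
- exact/measurable_EFinP/(Lint_measurable (Le a _ Lu)).
- exact/measurable_EFinP/(Lint_measurable (Le b _ Lu)).
- move=> x _; rewrite lee_fin; apply: envelope_le_param => //.
  by rewrite ler_nat ltnS.
Qed.

Lemma opA_bounded_support (u : T -> R) (K : R) : measurable_fun [set: T] u ->
  (forall x, `|u x| <= K) -> Lint nu1 (fun x => Num.sg (u x) ^+ 2) ->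
  exists v, opA p nu1 m1 nu2 m2 mu u v.
Proof.
move=> mu_ uK usupp.
have usupp2 := Lint_density_bounded mmu nu2E muM c0 cmu usupp.
have D1 := subdiff_F1_sign sfin1 rev1 mu_ uK usupp.
have Dp := Deltap_bounded_support sfin2 rev2 mu_ uK usupp2 p1.
set g := (fun x => - _) in D1; set w := kint m2 _ in Dp.
have [Lu Lg _ _] := D1; have [_ Lw _ _] := Dp.
have Lmw : inL2 nu1 (fun x => mu x * w x).
  by apply: (inL2_density_mul mmu muM); apply/(inL2_density mmu nu2E muM c0 cmu).
exists (fun x => g x - mu x * w x); split => //; first exact: inL2B.
exists g, (fun x => - (mu x * w x)), w; split => //.
- rewrite /Delta1 (_ : (fun x => - - g x) = g)//.
  by apply/funext => x; rewrite opprK.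
- exact: aeW.
- exact: aeW.
Qed.

(* Soft-thresholding at level 1/(n+1) cuts the support down to finite measure. *)
Definition soft (n : nat) (t : R) : R :=
  clip n.+1%:R (t - clip n.+1%:R^-1 t).

Let nS0 (n : nat) : 0 <= n.+1%:R :> R. Proof. by []. Qed.
Let nV0 (n : nat) : 0 <= n.+1%:R^-1 :> R. Proof. by rewrite invr_ge0. Qed.

Lemma measurable_soft n : measurable_fun [set: R] (soft n).
Proof.
apply: (measurableT_comp (measurable_clip (nS0 n))).
by apply: measurable_funB => //; exact: measurable_clip.
Qed.

Lemma soft_small n t : `|t| <= n.+1%:R^-1 -> soft n t = 0.
Proof. by move=> h; rewrite /soft (clip_id h) subrr clip0. Qed.

(** [soft n t] lies between 0 and t; this supplies the domination by [f ^+ 2] in the density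
    argument. *)
Lemma soft_dist_le n t : `|t - soft n t| <= `|t|.
Proof.
rewrite /soft; have := nS0 n; have := nV0 n.
move: (n.+1%:R : R) (n.+1%:R^-1 : R) => K e e0 K0.
rewrite /clip; case: (ltP t (- e)) => h1; last case: (ltP e t) => h2.
- rewrite [leRHS]ltr0_norm; last by lra.
  by rewrite ler_norml; case: ltP => h3; last case: ltP => h4; lra.
- rewrite [leRHS]gtr0_norm; last by lra.
  by rewrite ler_norml; case: ltP => h3; last case: ltP => h4; lra.
- by rewrite subrr oppr_gt0 !ltNge K0/= subr0.
Qed.

Lemma soft_cvg t : soft n t @[n --> \oo] --> t.
Proof.
apply/cvgrPdist_lt => e e0; near=> n.
have tn : `|t| <= n.+1%:R.
  apply: (@le_trans _ _ n%:R); last by rewrite ler_nat.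
  by near: n; exact: nbhs_infty_ger.
have ne : n.+1%:R^-1 < e by near: n; exact: (near_infty_natSinv_lt (PosNum e0)).
rewrite /soft clip_id; last exact: le_trans (clip_dist_le _ (nV0 n)) tn.
by rewrite opprB addrC subrK (le_lt_trans (clip_bound _ (nV0 n))).
Unshelve. all: by end_near. Qed.

Lemma opA_dense_domain : dense_domain nu1 (opA p nu1 m1 nu2 m2 mu).
Proof.
move=> f Lf eps eps0; have mf := inL2_measurable Lf.
have lf := inL2_Lint_sqr Lf.
pose u n x := soft n (f x).
have mu_ n : measurable_fun [set: T] (u n).
  exact: (measurableT_comp (measurable_soft n) mf).
(* Chebyshev: the support of [u n] lies where |f| > 1/(n+1), so its indicator is at most (n+1)^2
   f^2. *)
have usupp n : Lint nu1 (fun x => Num.sg (u n x) ^+ 2).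
  apply: Lint_le (LintZ (n.+1%:R ^+ 2) lf) _ => [|x].
    apply: measurable_funX; apply: (measurableT_comp _ (mu_ n)).
    exact: (@measurable_sgr R).
  rewrite ger0_norm ?sqr_ge0// sqr_sg.
  have [h|h] := leP `|f x| n.+1%:R^-1.
    by rewrite /u soft_small// eqxx mulr_ge0// sqr_ge0.
  rewrite (@le_trans _ _ 1)//; first by case: (_ != 0).
  rewrite -exprMn -real_normK ?num_real// exprn_ege1// normrM gtr0_norm//.
  by rewrite -ler_pdivrMl// mulr1 ltW.
have mfu n : measurable_fun [set: T] (fun x => (f x - u n x) ^+ 2).
  by apply: measurable_funX; exact: measurable_funB.
have [] := @RI_cvg _ _ _ nu1 (fun n x => (f x - u n x) ^+ 2) (fun=> 0)
  (fun x => f x ^+ 2) mfu (measurable_cst _) lf.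
- move=> n x; rewrite ger0_norm ?sqr_ge0//.
  rewrite -real_normK ?num_real// -[leRHS]real_normK ?num_real//.
  by rewrite lerXn2r ?nnegrE// soft_dist_le.
- move=> x; have : f x - u n x @[n --> \oo] --> (0 : R).
    rewrite -(subrr (f x)); apply: cvgB; first exact: cvg_cst.
    exact: soft_cvg.
  move=> h; have h2 := cvgM h h; rewrite mulr0 in h2.
  have -> : (fun n => (f x - u n x) ^+ 2) =
      (fun n => (f x - u n x) * (f x - u n x)) by apply/funext => n; rewrite expr2.
  exact: h2.
rewrite (_ : RI nu1 (fun=> 0) = 0); last by rewrite /RI Rintegral_cst// mul0r.
move=> _ /cvgr_lt/(_ eps eps0)/filter_ex[n hn].
have [v A] := opA_bounded_support (mu_ n) (fun x => clip_bound _ (nS0 n)) (usupp n).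
exists (u n); split; first by exists v.
rewrite EFin_RI ?lte_fin//; apply: Lint_le lf _ => // x.
rewrite ger0_norm ?sqr_ge0//.
rewrite -real_normK ?num_real// -[leRHS]real_normK ?num_real//.
by rewrite lerXn2r ?nnegrE// soft_dist_le.
Qed.

End accretivity.

Theorem theorem3p1 (d : measure_display) (T : measurableType d) (R : realType)
  (p : R) (m1 m2 : R.-pker T ~> T) (nu1 nu2 : {measure set T -> \bar R})
  (mu : T -> R) (c : R) :
  1 < p ->
  random_walk_space m1 nu1 -> reversible m1 nu1 ->
  random_walk_space m2 nu2 -> reversible m2 nu2 ->
  (* mu = d nu2 / d nu1 (so nu2 << nu1), mu in L^oo(X,nu1), mu >= c > 0 *)
  measurable_fun [set: T] mu ->
  (forall A, measurable A -> nu2 A = (\int[nu1]_(x in A) (mu x)%:E)%E) ->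
  (exists M : R, {ae nu1, forall x, `|mu x| <= M}) ->
  0 < c -> {ae nu1, forall x, c <= mu x} ->
  ((nu1 [set: T] < +oo)%E \/ (nu1 [set: T] = +oo%E /\ 2 <= p)) ->
  (forall u v : T -> R,
     subdiff nu1 (fun w => (F1 nu1 m1 w + Fp p nu2 m2 w)%E) u v
     <-> opA p nu1 m1 nu2 m2 mu u v) /\
  completely_accretive nu1 (opA p nu1 m1 nu2 m2 mu) /\
  dense_domain nu1 (opA p nu1 m1 nu2 m2 mu).
Proof.
move=> p1 [_ sfin1 _] rev1 [_ sfin2 _] rev2 mmu nu2E [M muM] c0 cmu fin.
have fin1 : (nu1 [set: T] < +oo)%E \/ 2 <= p by case: fin => [|[_]]; [left|right].
split; last split.
- move=> u v; split.
    exact: (subdiff_opA p1 sfin1 rev1 sfin2 rev2 mmu nu2E muM c0 cmu fin1).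
  exact: (opA_subdiff p1 sfin2 rev2 mmu nu2E muM c0 cmu fin1).
- exact: (opA_completely_accretive p1 sfin2 rev2 mmu nu2E muM c0 cmu fin1).
- exact: (opA_dense_domain p1 sfin1 rev1 sfin2 rev2 mmu nu2E muM c0 cmu).
Qed.
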